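(* For every $n\ge 3$, $$\mathcal{G}_n=\langle a,b,c\mid a^2,b^2,c^2,(bc)^2,u_0,\ldots,u_{n-3},v_0,\ldots,v_{n-4},w_n,t_n\rangle,$$ where $$u_i=\sigma^i((abc)^4),\quad v_i=\sigma^i((abcacac)^4),\quad w_n=\sigma^{n-3}((ac)^4),\quad t_n=\sigma^{n-3}((abac)^4),$$ and $\sigma$ is the substitution (endomorphism of the free group on $\{a,b,c\}$) given by $a\mapsto aca$, $b\mapsto bc$, $c\mapsto b$. Moreover this presentation is minimal and realizes the deficiency $\mathrm{def}(\mathcal{G}_n)=2n-2$.
   Context: Let $X=\{0,1\}$ and let $X^*$ be the set of finite words over $X$, viewed as the binary rooted tree (the root is the empty word, and the children of $w$ are $w0,w1$). The Grigorchuk group $\mathcal{G}\le \mathrm{Aut}(X^* )$ is the group generated by the tree automorphisms $a,b,c,d$ defined recursively for $w\in X^*$ by: $a(0w)=1w$, $a(1w)=0w$; $b(0w)=0\,a(w)$, $b(1w)=1\,c(w)$; $c(0w)=0\,a(w)$, $c(1w)=1\,d(w)$; $d(0w)=0w$, $d(1w)=1\,b(w)$ (all fix the empty word). For $n\ge1$, $St_{\mathcal{G}}(n)$ is the normal subgroup of elements of $\mathcal{G}$ fixing every word of length $n$, and $\mathcal{G}_n=\mathcal{G}/St_{\mathcal{G}}(n)$. The letters $a,b,c$ in the presentation correspond to the images in $\mathcal{G}_n$ of $a,b,c\in\mathcal{G}$. For $n=3$ the list $v_0,\dots,v_{n-4}$ is empty. For a group $G$: $d(G)$ is the minimal number of generators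 of $G$; $r(G)$ is the minimal $m$ such that $G$ has a presentation $\langle x_1,\dots,x_t\mid r_1,\dots,r_m\rangle$ with $m$ relators (for some $t$); the deficiency $\mathrm{def}(G)$ is the minimal value of $m-t$ over all presentations of $G$ with $t$ generators and $m$ relators. A presentation with $t$ generators and $m$ relators is called minimal if $t=d(G)$ and $m=r(G)$; it realizes the deficiency if $m-t=\mathrm{def}(G)$. *)

(* Defs.v *)
From HB Require Import structures.
From mathcomp Require Import all_boot all_order all_algebra.
From mathcomp Require Import generic_quotient boolp classical_sets.

Set Implicit Arguments.
Unset Strict Implicit.
Unset Printing Implicit Defensive.

Local Open Scope group_scope.
Local Open Scope quotient_scope.

Section Generated.
Variable G : groupType.

Definition gen_subgroup (S : set G) : {pred G} := fun x =>
  `[< forall H : {pred G}, group_closed H -> (forall s, S s -> s \in H) ->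
      x \in H >].

Lemma gen_subgroup_closed S : group_closed (gen_subgroup S).
Proof.
split=> [|x y /asboolP hx /asboolP hy]; apply/asboolP => H cH SH.
  by case: cH.
by case: (cH) => _; apply; [exact: hx | exact: hy].
Qed.

Lemma mem_gen_subgroup (S : set G) s : S s -> s \in gen_subgroup S.
Proof. by move=> Ss; apply/asboolP => H _; apply. Qed.

End Generated.

Section Quotient.
Variable G : groupType.

Record normalSubgroup := NormalSubgroup {
  nsub_pred :> {pred G};
  nsub_closed : group_closed nsub_pred;
  nsub_conj : forall x g, x \in nsub_pred -> x ^ g \in nsub_pred }.

Variable N : normalSubgroup.

Lemma nsub1 : 1 \in N.
Proof. by case: (nsub_closed N). Qed.

Lemma nsubF x y : x \in N -> y \in N -> x / y \in N.
Proof. by case: (nsub_closed N) => _; apply. Qed.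

Lemma nsubV x : x \in N -> x^-1 \in N.
Proof. by move=> Nx; rewrite -[x^-1]mul1g; apply: nsubF => //; exact: nsub1. Qed.

Lemma nsubM x y : x \in N -> y \in N -> x * y \in N.
Proof. by move=> Nx Ny; rewrite -[y]invgK; apply: nsubF => //; exact: nsubV. Qed.

Definition same_coset : rel G := fun x y => x^-1 * y \in N.

Lemma same_coset_equiv : equiv_class_of same_coset.
Proof.
have sym x y : same_coset x y -> same_coset y x.
  by move=> /nsubV; rewrite invgM invgK.
split=> [x|x y|y x z] /=; first by rewrite /same_coset mulVg nsub1.
  by apply/idP/idP; exact: sym.
move=> xy yz; have := nsubM xy yz.
by rewrite -mulgA (mulgA y) mulgV mul1g.
Qed.

Canonical same_coset_equivrel := EquivRelPack same_coset_equiv.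

Definition quotient_grp := {eq_quot same_coset_equivrel}.

HB.instance Definition _ := Choice.on quotient_grp.

Definition to_quotient (x : G) : quotient_grp := \pi_({eq_quot same_coset_equivrel}) x.

Lemma to_quotientP x y : to_quotient x = to_quotient y <-> x^-1 * y \in N.
Proof. by split=> [/eqmodP|h]; last apply/eqmodP. Qed.

Definition quot_repr (u : quotient_grp) : G := repr (u : {eq_quot same_coset_equivrel}).

Lemma quot_reprK u : to_quotient (quot_repr u) = u.
Proof. exact: reprK. Qed.

Definition quot_one : quotient_grp := to_quotient 1.
Definition quot_mul (u v : quotient_grp) : quotient_grp :=
  to_quotient (quot_repr u * quot_repr v).
Definition quot_inv (u : quotient_grp) : quotient_grp := to_quotient (quot_repr u)^-1.

Lemma to_quotientM x y :
  to_quotient (x * y) = quot_mul (to_quotient x) (to_quotient y).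
Proof.
have /to_quotientP hx := quot_reprK (to_quotient x).
have /to_quotientP hy := quot_reprK (to_quotient y).
apply/esym/to_quotientP; set x' := quot_repr _ in hx *; set y' := quot_repr _ in hy *.
have -> : (x' * y')^-1 * (x * y) = (x'^-1 * x) ^ y' * (y'^-1 * y).
  by rewrite /conjg !invgM !mulgA mulgK.
by apply: nsubM => //; exact: nsub_conj.
Qed.

Lemma to_quotientV x : to_quotient x^-1 = quot_inv (to_quotient x).
Proof.
have /to_quotientP hx := quot_reprK (to_quotient x).
apply/to_quotientP; rewrite invgK; set x' := quot_repr _ in hx *.
have -> : x * x'^-1 = (x'^-1 * x) ^ x'^-1.
  by rewrite /conjg !mulgA invgK mulgV mul1g.
exact: nsub_conj.
Qed.

Lemma quot_mulA : associative quot_mul.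
Proof.
by move=> u v w; rewrite -(quot_reprK u) -(quot_reprK v) -(quot_reprK w)
  -!to_quotientM mulgA.
Qed.

Lemma quot_mul1g : left_id quot_one quot_mul.
Proof. by move=> u; rewrite -(quot_reprK u) -to_quotientM mul1g. Qed.

Lemma quot_mulg1 : right_id quot_one quot_mul.
Proof. by move=> u; rewrite -(quot_reprK u) -to_quotientM mulg1. Qed.

Lemma quot_mulVg : left_inverse quot_one quot_inv quot_mul.
Proof.
by move=> u; rewrite -(quot_reprK u) -to_quotientV -to_quotientM mulVg.
Qed.

Lemma quot_mulgV : right_inverse quot_one quot_inv quot_mul.
Proof.
by move=> u; rewrite -(quot_reprK u) -to_quotientV -to_quotientM mulgV.
Qed.

HB.instance Definition _ := isGroup.Build quotient_grp
  quot_mulA quot_mul1g quot_mulg1 quot_mulVg quot_mulgV.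

End Quotient.

(* Elements of the free group on I are represented by (not necessarily
   reduced) words; the letter (i, false) is the generator i and (i, true) its
   inverse. *)
Section Words.
Variable I : Type.

Definition word := seq (I * bool).

Definition inv_letter (l : I * bool) : I * bool := (l.1, ~~ l.2).

Definition inv_word (u : word) : word := rev (map inv_letter u).

Definition pow_word (u : word) (k : nat) : word := flatten (nseq k u).

End Words.

(* Preimage, in the monoid of words, of the normal closure in the free group
   on I of the elements represented by the words of R. *)
Inductive normal_closure (I : eqType) (R : seq (word I)) : word I -> Prop :=
| Ncl_relator r : r \in R -> normal_closure R r
| Ncl_one : normal_closure R [::]
| Ncl_mul u v :
    normal_closure R u -> normal_closure R v -> normal_closure R (u ++ v)
| Ncl_inv u : normal_closure R u -> normal_closure R (inv_word u)
| Ncl_conj u g :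
    normal_closure R u -> normal_closure R (inv_word g ++ u ++ g)
| Ncl_insert u l v :
    normal_closure R (u ++ v) -> normal_closure R (u ++ [:: l; inv_letter l] ++ v)
| Ncl_delete u l v :
    normal_closure R (u ++ [:: l; inv_letter l] ++ v) -> normal_closure R (u ++ v).

(* The endomorphism of the free group with i |-> f i. *)
Definition subst_word (I : Type) (f : I -> word I) (u : word I) : word I :=
  flatten [seq (if l.2 then inv_word (f l.1) else f l.1) | l <- u].

Section Presentations.
Variable G : groupType.

Definition eval_word (I : Type) (x : I -> G) (u : word I) : G :=
  \prod_(l <- u) (if l.2 then (x l.1)^-1 else x l.1).

Definition generates (t : nat) (x : 'I_t -> G) :=
  forall g : G, g \in gen_subgroup (range x).

(* The homomorphism from the free group on 'I_t sending each i to x i is onto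
   and its kernel is the normal closure of R. *)
Definition presents (t : nat) (x : 'I_t -> G) (R : seq (word 'I_t)) :=
  generates x /\ forall u, eval_word x u = 1 <-> normal_closure R u.

Definition has_presentation (t m : nat) :=
  exists (x : 'I_t -> G) (R : seq (word 'I_t)), size R = m /\ presents x R.

Definition is_least d (T : porderType d) (P : T -> Prop) (k : T) :=
  P k /\ forall j, P j -> (k <= j)%O.

Definition is_generator_number (k : nat) :=
  is_least (fun t : nat => exists x : 'I_t -> G, generates x) k.

Definition is_relator_number (k : nat) :=
  is_least (fun m : nat => exists t, has_presentation t m) k.

Definition is_deficiency (k : int) :=
  is_least (fun z : int =>
    exists t m : nat, has_presentation t m /\ z = (m%:Z - t%:Z)%R) k.

Definition minimal_presentation (t : nat) (x : 'I_t -> G)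
    (R : seq (word 'I_t)) :=
  [/\ presents x R, is_generator_number t & is_relator_number (size R)].

Definition realizes_deficiency (t : nat) (x : 'I_t -> G)
    (R : seq (word 'I_t)) :=
  presents x R /\ is_deficiency ((size R)%:Z - t%:Z)%R.

End Presentations.

Record treeAut := TreeAut {
  taut :> seq bool -> seq bool;
  taut_inv : seq bool -> seq bool;
  tautK : cancel taut taut_inv;
  taut_invK : cancel taut_inv taut;
  taut_root : taut [::] = [::];
  taut_child : forall w x, exists y, taut (rcons w x) = rcons (taut w) y }.

HB.instance Definition _ := gen_eqMixin treeAut.
HB.instance Definition _ := gen_choiceMixin treeAut.

Lemma treeAutP (f g : treeAut) : f =1 g -> f = g.
Proof.
case: f g => [f f' fK f'K f0 fc] [g g' gK g'K g0 gc] /= /funext fg.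
subst g.
have f'g' : f' = g' by apply/funext => w; rewrite -[w in LHS]g'K fK.
by subst g'; congr TreeAut; exact: Prop_irrelevance.
Qed.

Lemma size_taut (f : treeAut) w : size (f w) = size w.
Proof.
elim/last_ind: w => [|w x IHw]; first by rewrite taut_root.
by have [y ->] := taut_child f w x; rewrite !size_rcons IHw.
Qed.

Section TreeAutGroup.

Lemma taut_inv_root (f : treeAut) : taut_inv f [::] = [::].
Proof. by rewrite -[RHS](tautK f) taut_root. Qed.

Lemma taut_inv_child (f : treeAut) w x :
  exists y, taut_inv f (rcons w x) = rcons (taut_inv f w) y.
Proof.
case/lastP e: (taut_inv f (rcons w x)) => [|v y].
  by move/(congr1 f): e; rewrite taut_invK taut_root; case: w.
exists y; congr rcons; have [z ez] := taut_child f v y.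
move/(congr1 f): e; rewrite taut_invK ez => /rcons_inj[-> _].
by rewrite tautK.
Qed.

Definition taut_one : treeAut :=
  @TreeAut id id (fun=> erefl) (fun=> erefl) erefl
    (fun w x => ex_intro _ x erefl).

Lemma taut_comp_root (f g : treeAut) : f (g [::]) = [::].
Proof. by rewrite !taut_root. Qed.

Lemma taut_comp_child (f g : treeAut) w x :
  exists y, f (g (rcons w x)) = rcons (f (g w)) y.
Proof. by have [y ->] := taut_child g w x; exact: taut_child. Qed.

Definition taut_mul (f g : treeAut) : treeAut :=
  @TreeAut (f \o g) (taut_inv g \o taut_inv f)
    (can_comp (tautK f) (tautK g)) (can_comp (taut_invK g) (taut_invK f))
    (taut_comp_root f g) (taut_comp_child f g).

Definition taut_invg (f : treeAut) : treeAut :=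
  TreeAut (taut_invK f) (tautK f) (taut_inv_root f) (taut_inv_child f).

Lemma taut_mulA : associative taut_mul.
Proof. by move=> f g h; exact: treeAutP. Qed.
Lemma taut_mul1g : left_id taut_one taut_mul.
Proof. by move=> f; exact: treeAutP. Qed.
Lemma taut_mulg1 : right_id taut_one taut_mul.
Proof. by move=> f; exact: treeAutP. Qed.
Lemma taut_mulVg : left_inverse taut_one taut_invg taut_mul.
Proof. by move=> f; apply: treeAutP => w; exact: tautK. Qed.
Lemma taut_mulgV : right_inverse taut_one taut_invg taut_mul.
Proof. by move=> f; apply: treeAutP => w; exact: taut_invK. Qed.

HB.instance Definition _ := isGroup.Build treeAut
  taut_mulA taut_mul1g taut_mulg1 taut_mulVg taut_mulgV.

End TreeAutGroup.

(* The letter 0 is [false] and the letter 1 is [true]. *)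
Definition fun_a (w : seq bool) : seq bool :=
  if w is x :: w' then ~~ x :: w' else [::].

Fixpoint fun_b (w : seq bool) : seq bool :=
  match w with
  | [::] => [::]
  | false :: w' => false :: fun_a w'
  | true :: w' => true :: fun_c w'
  end
with fun_c (w : seq bool) : seq bool :=
  match w with
  | [::] => [::]
  | false :: w' => false :: fun_a w'
  | true :: w' => true :: fun_d w'
  end
with fun_d (w : seq bool) : seq bool :=
  match w with
  | [::] => [::]
  | false :: w' => false :: w'
  | true :: w' => true :: fun_b w'
  end.

Lemma fun_aK : involutive fun_a.
Proof. by case=> //= x w; rewrite negbK. Qed.

Lemma fun_bcdK w :
  [/\ fun_b (fun_b w) = w, fun_c (fun_c w) = w & fun_d (fun_d w) = w].
Proof.
elim: w => //= -[] w [hb hc hd] /=; first by rewrite hb hc hd.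
by rewrite fun_aK.
Qed.

Lemma fun_bK : involutive fun_b. Proof. by move=> w; case: (fun_bcdK w). Qed.
Lemma fun_cK : involutive fun_c. Proof. by move=> w; case: (fun_bcdK w). Qed.
Lemma fun_dK : involutive fun_d. Proof. by move=> w; case: (fun_bcdK w). Qed.

Lemma fun_a_child w x : exists y, fun_a (rcons w x) = rcons (fun_a w) y.
Proof. by case: w => [|z w] /=; [exists (~~ x) | exists x]. Qed.

Lemma fun_bcd_child w x :
  [/\ exists y, fun_b (rcons w x) = rcons (fun_b w) y,
      exists y, fun_c (rcons w x) = rcons (fun_c w) y
    & exists y, fun_d (rcons w x) = rcons (fun_d w) y].
Proof.
elim: w => [|z w [[yb hb] [yc hc] [yd hd]]] /=.
  by case: x; split; by [exists true | exists false].
case: z => /=; first by rewrite hb hc hd; split; eexists.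
by have [ya ->] := fun_a_child w x; split; eexists.
Qed.

Lemma fun_b_child w x : exists y, fun_b (rcons w x) = rcons (fun_b w) y.
Proof. by case: (fun_bcd_child w x). Qed.
Lemma fun_c_child w x : exists y, fun_c (rcons w x) = rcons (fun_c w) y.
Proof. by case: (fun_bcd_child w x). Qed.
Lemma fun_d_child w x : exists y, fun_d (rcons w x) = rcons (fun_d w) y.
Proof. by case: (fun_bcd_child w x). Qed.

Definition aut_a : treeAut := TreeAut fun_aK fun_aK erefl fun_a_child.
Definition aut_b : treeAut := TreeAut fun_bK fun_bK erefl fun_b_child.
Definition aut_c : treeAut := TreeAut fun_cK fun_cK erefl fun_c_child.
Definition aut_d : treeAut := TreeAut fun_dK fun_dK erefl fun_d_child.

Definition grig_gens : set treeAut :=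
  [set g | [\/ g = aut_a, g = aut_b, g = aut_c | g = aut_d]]%classic.

Definition grig_pred : {pred treeAut} := gen_subgroup grig_gens.

Lemma grig_closed : group_closed grig_pred.
Proof. exact: gen_subgroup_closed. Qed.

Definition grigorchuk := {g : treeAut | g \in grig_pred}.

HB.instance Definition _ := SubChoice.on grigorchuk.
HB.instance Definition _ :=
  SubChoice_isSubGroup.Build treeAut grig_pred grigorchuk grig_closed.

Definition grig_a : grigorchuk :=
  exist _ aut_a (mem_gen_subgroup (Or41 _ _ _ erefl : grig_gens aut_a)).
Definition grig_b : grigorchuk :=
  exist _ aut_b (mem_gen_subgroup (Or42 _ _ _ erefl : grig_gens aut_b)).
Definition grig_c : grigorchuk :=
  exist _ aut_c (mem_gen_subgroup (Or43 _ _ _ erefl : grig_gens aut_c)).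

Section Stabilizer.
Variable n : nat.

Definition stab_pred : {pred grigorchuk} := fun g =>
  `[< forall w : seq bool, size w = n -> val g w = w >].

Lemma stab_closed : group_closed stab_pred.
Proof.
split=> [|g h /asboolP hg /asboolP hh]; apply/asboolP => w sw //.
have -> : val (g / h) w = val g (taut_inv (val h) w) by [].
by rewrite -{1}(hh w sw) tautK hg.
Qed.

Lemma stab_conj g h : g \in stab_pred -> g ^ h \in stab_pred.
Proof.
move=> /asboolP hg; apply/asboolP => w sw.
have -> : val (g ^ h) w = taut_inv (val h) (val g (val h w)) by [].
by rewrite hg ?size_taut // tautK.
Qed.

Definition stab : normalSubgroup grigorchuk :=
  NormalSubgroup stab_closed stab_conj.

Definition grig_quot : groupType := quotient_grp stab.

Definition grig_quot_gens (i : 'I_3) : grig_quot :=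
  to_quotient stab (nth 1 [:: grig_a; grig_b; grig_c] i).

End Stabilizer.

Local Notation a := (Ordinal (isT : 0 < 3)%N, false).
Local Notation b := (Ordinal (isT : 1 < 3)%N, false).
Local Notation c := (Ordinal (isT : 2 < 3)%N, false).

Definition sigma : word 'I_3 -> word 'I_3 :=
  subst_word (fun i : 'I_3 => nth [::] [:: [:: a; c; a]; [:: b; c]; [:: b]] i).

Definition rel_u (i : nat) : word 'I_3 :=
  iter i sigma (pow_word [:: a; b; c] 4).
Definition rel_v (i : nat) : word 'I_3 :=
  iter i sigma (pow_word [:: a; b; c; a; c; a; c] 4).
Definition rel_w (n : nat) : word 'I_3 :=
  iter (n - 3) sigma (pow_word [:: a; c] 4).
Definition rel_t (n : nat) : word 'I_3 :=
  iter (n - 3) sigma (pow_word [:: a; b; a; c] 4).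

Definition grig_relators (n : nat) : seq (word 'I_3) :=
  [:: pow_word [:: a] 2; pow_word [:: b] 2; pow_word [:: c] 2;
      pow_word [:: b; c] 2]
  ++ [seq rel_u i | i <- iota 0 (n - 2)]
  ++ [seq rel_v i | i <- iota 0 (n - 3)]
  ++ [:: rel_w n; rel_t n].

(* Main.v *)
Require Import Defs.
From HB Require Import structures.
From mathcomp Require Import all_boot all_order all_algebra.
From mathcomp Require Import generic_quotient boolp classical_sets.
From mathcomp Require Import zify.

(**
Write N_n for the normal subgroup of the free group F on a, b, c consisting of
the words acting trivially on level n.  The sections of sigma(u) at the vertices
0 and 1 are theta(u) and u, where theta maps a, b, c to bc, 1, a.

Presentation, by induction on n.  Modulo the relators of level n+1, put
d = bc, c' = aca, d' = ada.  The relators u_0 and v_0 say that d' commutes with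
d and with its conjugate by c'c, and u_1 says that (cc')^4 = 1; hence d'
commutes with all conjugates of d under sigma(F), and every word is a product
a^e . (a sigma(y) a) . sigma(k) with theta(y) = 1.  If this product lies in
N_(n+1), then e = 0, k is in N_n, theta(k) = 1 in the Grigorchuk group because
theta(F) is dihedral of order 8 there and the relators are fourth powers, and so
y is in N_n too.  By induction sigma(y) and sigma(k) are trivial.  For n = 3 the
relators allow at most 128 normal forms, and these act differently on level 3.

Minimality.  If N is the kernel of F -> G, then m - t + 3 is at least the
dimension of N / [N, F] N^2 for every presentation of G with t generators and m
relators, because the relators lie in F^2.  So it suffices to find functionals
on N_n / [N_n, F] N_n^2 that take arbitrary values on the 2n+1 relators.
A functional on N_n vanishing on u_0 yields one on N_(n+1), by adding its values
at the two sections of a word; this prescribes the values on the sigma(r).  The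
values on u_0, v_0, u_1 are adjusted by functionals that come from explicit
finite 2-groups of tree automorphisms, in which the relators evaluate to the
identity or to the central element changing the last letter.
*)

Set Implicit Arguments.
Unset Strict Implicit.
Unset Printing Implicit Defensive.

Local Open Scope group_scope.
Local Notation ia := (Ordinal (isT : 0 < 3)%N).
Local Notation ib := (Ordinal (isT : 1 < 3)%N).
Local Notation ic := (Ordinal (isT : 2 < 3)%N).

(** * Words and presented groups *)

Section WordTheory.
Variable I : Type.
Implicit Types (u v : word I) (l : I * bool).

Lemma inv_letterK : involutive (@inv_letter I).
Proof. by case=> i e; rewrite /inv_letter /= negbK. Qed.

Lemma inv_word_cat u v : inv_word (u ++ v) = inv_word v ++ inv_word u.
Proof. by rewrite /inv_word map_cat rev_cat. Qed.

Lemma inv_word_cons l u : inv_word (l :: u) = rcons (inv_word u) (inv_letter l).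
Proof. by rewrite /inv_word /= rev_cons. Qed.

Lemma inv_wordK : involutive (@inv_word I).
Proof.
move=> u; rewrite /inv_word map_rev revK -map_comp -[RHS]map_id.
by apply: eq_map => l; exact: inv_letterK.
Qed.

Lemma pow_wordS u k : pow_word u k.+1 = u ++ pow_word u k.
Proof. by []. Qed.

End WordTheory.

Section HomWord.
Variables (I J : Type) (f : I -> word J).

(* [subst_word] with a codomain on another set of generators. *)
Definition hom_word (u : word I) : word J :=
  flatten [seq (if l.2 then inv_word (f l.1) else f l.1) | l <- u].

Lemma hom_word_cat u v :
  hom_word (u ++ v) = hom_word u ++ hom_word v.
Proof. by rewrite /hom_word map_cat flatten_cat. Qed.

Lemma hom_word_cons l u : hom_word (l :: u) =
  (if l.2 then inv_word (f l.1) else f l.1) ++ hom_word u.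
Proof. by []. Qed.

Lemma hom_word_inv u : hom_word (inv_word u) = inv_word (hom_word u).
Proof.
elim: u => //= l u IHu; rewrite inv_word_cons -cats1 hom_word_cat IHu.
rewrite hom_word_cons inv_word_cat /=; congr (_ ++ _).
by case: l => i []; rewrite /hom_word /= cats0 ?inv_wordK.
Qed.

Lemma hom_word_pow u k :
  hom_word (pow_word u k) = pow_word (hom_word u) k.
Proof. by elim: k => //= k IHk; rewrite pow_wordS hom_word_cat IHk. Qed.

End HomWord.

Section Eval.
Variables (G : groupType) (I : Type) (x : I -> G).
Implicit Types u v : word I.

Lemma eval_nil : eval_word x [::] = 1.
Proof. by rewrite /eval_word big_nil. Qed.

Lemma eval_cons l u :
  eval_word x (l :: u) = (if l.2 then (x l.1)^-1 else x l.1) * eval_word x u.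
Proof. by rewrite /eval_word big_cons. Qed.

Lemma eval_cat u v : eval_word x (u ++ v) = eval_word x u * eval_word x v.
Proof. by rewrite /eval_word big_cat. Qed.

Lemma eval_inv u : eval_word x (inv_word u) = (eval_word x u)^-1.
Proof.
elim: u => [|[i e] u IHu]; first by rewrite eval_nil invg1.
rewrite inv_word_cons -cats1 eval_cat IHu !eval_cons eval_nil mulg1 invgM.
by case: e; rewrite ?invgK.
Qed.

Lemma eval_pow u k : eval_word x (pow_word u k) = eval_word x u ^+ k.
Proof.
elim: k => [|k IHk]; first by rewrite eval_nil expg0.
by rewrite pow_wordS eval_cat IHk expgS.
Qed.

Lemma eq_eval y u : x =1 y -> eval_word x u = eval_word y u.
Proof. by move=> xy; apply: eq_bigr => l _; rewrite xy. Qed.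

End Eval.

Lemma eval_hom_word (G : groupType) (I J : Type) (x : J -> G)
    (f : I -> word J) u :
  eval_word x (hom_word f u) = eval_word (fun i => eval_word x (f i)) u.
Proof.
elim: u => [|[i e] u IHu]; first by rewrite !eval_nil.
by rewrite hom_word_cons eval_cat IHu eval_cons /=; case: e; rewrite ?eval_inv.
Qed.

Lemma eval_morph (G H : groupType) (f : G -> H) (I : Type) (x : I -> G) u :
  {morph f : g h / g * h} -> f (eval_word x u) = eval_word (f \o x) u.
Proof.
move=> fM.
have f1 : f 1 = 1 by apply: (mulgI (f 1)); rewrite -fM !mulg1.
have fV g : f g^-1 = (f g)^-1 by apply: (mulgI (f g)); rewrite -fM !mulgV.
elim: u => [|[i e] u IHu]; first by rewrite !eval_nil.
by rewrite !eval_cons fM IHu /=; case: e; rewrite ?fV.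
Qed.

Definition normal_pred (G : groupType) (M : G -> Prop) :=
  [/\ M 1, forall g h, M g -> M h -> M (g * h), forall g, M g -> M g^-1
    & forall g h, M g -> M (g ^ h)].

Lemma normal_pred_trivial (G : groupType) : normal_pred (fun g : G => g = 1).
Proof.
by split=> [|g h -> ->|g ->|g h ->]; rewrite ?mulg1 ?invg1 ?conj1g.
Qed.

(** Each constructor of [normal_closure] preserves having a value in [M]: insertion and deletion do
    not change the value, and the others are the closure properties of a normal subgroup. With [M]
    trivial this is von Dyck's theorem; with [M] a level stabilizer or a center it bounds the values
    of a normal closure. *)
Lemma ncl_eval (I : eqType) (R : seq (word I)) (G : groupType) (x : I -> G) M :
    normal_pred M -> (forall r, r \in R -> M (eval_word x r)) ->
  forall u, normal_closure R u -> M (eval_word x u).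
Proof.
case=> M1 MM MV MJ RM u; elim => {u}.
- exact: RM.
- by rewrite eval_nil.
- by move=> u v _ Mu _ Mv; rewrite eval_cat; exact: MM.
- by move=> u _ Mu; rewrite eval_inv; exact: MV.
- by move=> u g _ Mu; rewrite !eval_cat eval_inv; exact: MJ.
- move=> u [i e] v _; rewrite !eval_cat !eval_cons eval_nil mulg1 /=.
  by case: e; rewrite /= ?mulgV ?mulVg mul1g.
- move=> u [i e] v _; rewrite !eval_cat !eval_cons eval_nil mulg1 /=.
  by case: e; rewrite /= ?mulgV ?mulVg mul1g.
Qed.

Section NormalClosure.
Variables (I : eqType) (R : seq (word I)).
Local Notation ncl := (normal_closure R).

Lemma ncl_cancel p v q : ncl (p ++ (v ++ inv_word v) ++ q) <-> ncl (p ++ q).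
Proof.
elim: v p q => [|l v IHv] p q //=.
have -> : p ++ l :: (v ++ inv_word (l :: v)) ++ q =
    (p ++ [:: l]) ++ (v ++ inv_word v) ++ ([:: inv_letter l] ++ q).
  by rewrite inv_word_cons -cats1 -!catA.
split=> [/IHv|h]; first by rewrite -!catA; exact: Ncl_delete.
by apply/IHv; rewrite -!catA; exact: Ncl_insert.
Qed.

Lemma ncl_cancelV p v q : ncl (p ++ (inv_word v ++ v) ++ q) <-> ncl (p ++ q).
Proof. by have := ncl_cancel p (inv_word v) q; rewrite inv_wordK. Qed.

End NormalClosure.

Section PresentedGroup.
Variables (I : choiceType) (R : seq (word I)).
Local Notation ncl := (normal_closure R).
Local Open Scope quotient_scope.

(** This turns membership in [normal_closure] into equality in a group, so that consequences of the
    relators can be derived by rewriting with group identities. *)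
Definition pres_eq : rel (word I) := fun u v => `[< ncl (inv_word u ++ v) >].

Lemma pres_eq_equiv : equiv_class_of pres_eq.
Proof.
have sym u v : pres_eq u v -> pres_eq v u.
  move=> /asboolP/Ncl_inv h; apply/asboolP.
  by rewrite inv_word_cat inv_wordK in h.
split=> [u|u v|v u w] /=.
- have [_ h] := ncl_cancelV R [::] u [::]; apply/asboolP.
  by rewrite /= cats0 in h; apply: h; exact: Ncl_one.
- by apply/idP/idP; exact: sym.
- move=> /asboolP uv /asboolP vw; apply/asboolP.
  have := Ncl_mul uv vw; rewrite -catA (catA v) => h.
  by apply/(ncl_cancel R (inv_word u) v w).
Qed.

Canonical pres_eq_equivrel := EquivRelPack pres_eq_equiv.

Definition pres_group := {eq_quot pres_eq_equivrel}.

HB.instance Definition _ := Choice.on pres_group.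

Definition pres_class (u : word I) : pres_group :=
  \pi_({eq_quot pres_eq_equivrel}) u.

Definition pres_word (g : pres_group) : word I :=
  repr (g : {eq_quot pres_eq_equivrel}).

Lemma pres_wordK g : pres_class (pres_word g) = g.
Proof. exact: reprK. Qed.

Lemma pres_classP u v : pres_class u = pres_class v <-> ncl (inv_word u ++ v).
Proof. by split=> [/eqmodP/asboolP|h] //; apply/eqmodP/asboolP. Qed.

Definition pres_one : pres_group := pres_class [::].
Definition pres_mul (g h : pres_group) : pres_group :=
  pres_class (pres_word g ++ pres_word h).
Definition pres_inv (g : pres_group) : pres_group :=
  pres_class (inv_word (pres_word g)).

Lemma pres_class_cat u v :
  pres_class (u ++ v) = pres_mul (pres_class u) (pres_class v).
Proof.
have /pres_classP hu := pres_wordK (pres_class u).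
have /pres_classP hv := pres_wordK (pres_class v).
apply/esym/pres_classP; move: (pres_word _) (pres_word _) hu hv => v' u' hu hv.
have [h _] := ncl_cancel R (inv_word v' ++ inv_word u' ++ u) v' v.
have := Ncl_mul (Ncl_conj v' hu) hv.
by move: h; rewrite inv_word_cat -!catA.
Qed.

Lemma pres_class_inv u : pres_class (inv_word u) = pres_inv (pres_class u).
Proof.
have /esym/pres_classP hu := pres_wordK (pres_class u).
apply/pres_classP; move: (pres_word _) hu => u' hu; rewrite inv_wordK.
have [h _] := ncl_cancel R [::] u (u' ++ inv_word u).
have /= := Ncl_conj (inv_word u) hu; rewrite inv_wordK -!catA => hu'.
rewrite /= -!catA in h; have := Ncl_inv (h hu').
by rewrite inv_word_cat inv_wordK.
Qed.

Lemma pres_mulA : associative pres_mul.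
Proof.
move=> g h k; rewrite -(pres_wordK g) -(pres_wordK h) -(pres_wordK k).
by rewrite -!pres_class_cat catA.
Qed.

Lemma pres_mul1g : left_id pres_one pres_mul.
Proof. by move=> g; rewrite -(pres_wordK g) -pres_class_cat. Qed.

Lemma pres_mulg1 : right_id pres_one pres_mul.
Proof. by move=> g; rewrite -(pres_wordK g) -pres_class_cat cats0. Qed.

Lemma pres_mulVg : left_inverse pres_one pres_inv pres_mul.
Proof.
move=> g; rewrite -(pres_wordK g) -pres_class_inv -pres_class_cat.
apply/esym/pres_classP; have [_] := ncl_cancelV R [::] (pres_word g) [::].
by rewrite /= cats0; apply; exact: Ncl_one.
Qed.

Lemma pres_mulgV : right_inverse pres_one pres_inv pres_mul.
Proof.
move=> g; rewrite -(pres_wordK g) -pres_class_inv -pres_class_cat.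
apply/esym/pres_classP; have [_] := ncl_cancel R [::] (pres_word g) [::].
by rewrite /= cats0; apply; exact: Ncl_one.
Qed.

HB.instance Definition _ := isGroup.Build pres_group
  pres_mulA pres_mul1g pres_mulg1 pres_mulVg pres_mulgV.

Definition pres_gen (i : I) : pres_group := pres_class [:: (i, false)].

Lemma eval_pres_gen u : eval_word pres_gen u = pres_class u.
Proof.
elim: u => [|[i e] u IHu]; first by rewrite eval_nil.
rewrite eval_cons IHu -[_ :: u]cat1s pres_class_cat; congr (_ * _).
by case: e => //; rewrite -[[:: _]]/(inv_word [:: (i, false)]) pres_class_inv.
Qed.

Lemma eval_pres_gen_eq1 u : eval_word pres_gen u = 1 <-> ncl u.
Proof.
rewrite eval_pres_gen; split=> [/esym/pres_classP //|h].
by apply/esym/pres_classP.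
Qed.

Lemma eval_pres_gen_relator r : r \in R -> eval_word pres_gen r = 1.
Proof. by move=> Rr; apply/eval_pres_gen_eq1/Ncl_relator. Qed.

Section Lift.
Variables (G : groupType) (x : I -> G).
Hypothesis xR : forall r, r \in R -> eval_word x r = 1.

(** The value is read off a chosen representative word; [pres_lift_eval] shows that the choice does
    not matter once the relators hold for [x]. *)
Definition pres_lift (g : pres_group) : G := eval_word x (pres_word g).

Lemma pres_lift_eval u : pres_lift (eval_word pres_gen u) = eval_word x u.
Proof.
rewrite eval_pres_gen /pres_lift.
have /pres_classP h := pres_wordK (pres_class u).
have := ncl_eval (@normal_pred_trivial G) xR h.
by rewrite eval_cat eval_inv => /mulg1_eq; rewrite invgK.
Qed.

Lemma pres_liftM : {morph pres_lift : g h / g * h}.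
Proof.
move=> g h; rewrite -(pres_wordK g) -(pres_wordK h) -!eval_pres_gen -eval_cat.
by rewrite !pres_lift_eval eval_cat.
Qed.

End Lift.

End PresentedGroup.

(** * Tree automorphisms and their sections *)

Section Wreath.
Variable K : groupType.

(* [((f, g), s)] acts as [f] below the vertex 0 and as [g] below the vertex 1,
   and then exchanges the two vertices if [s]. *)
Definition wreath := (K * K * bool)%type.

HB.instance Definition _ := Choice.on wreath.

Definition wr_one : wreath := ((1, 1), false).
Definition wr_mul (f g : wreath) : wreath :=
  (if g.2 then (f.1.2 * g.1.1, f.1.1 * g.1.2)
   else (f.1.1 * g.1.1, f.1.2 * g.1.2), f.2 (+) g.2).
Definition wr_inv (f : wreath) : wreath :=
  (if f.2 then (f.1.2^-1, f.1.1^-1) else (f.1.1^-1, f.1.2^-1), f.2).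

Lemma wr_mulA : associative wr_mul.
Proof.
by move=> [[f0 f1] []] [[g0 g1] []] [[h0 h1] []]; rewrite /wr_mul /= !mulgA.
Qed.
Lemma wr_mul1g : left_id wr_one wr_mul.
Proof. by move=> [[f0 f1] []]; rewrite /wr_mul /= !mul1g. Qed.
Lemma wr_mulg1 : right_id wr_one wr_mul.
Proof. by move=> [[f0 f1] []]; rewrite /wr_mul /= !mulg1. Qed.
Lemma wr_mulVg : left_inverse wr_one wr_inv wr_mul.
Proof. by move=> [[f0 f1] []]; rewrite /wr_mul /= !mulVg. Qed.
Lemma wr_mulgV : right_inverse wr_one wr_inv wr_mul.
Proof. by move=> [[f0 f1] []]; rewrite /wr_mul /= !mulgV. Qed.

HB.instance Definition _ := isGroup.Build wreath
  wr_mulA wr_mul1g wr_mulg1 wr_mulVg wr_mulgV.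

Lemma wr_mulE (f g : wreath) : f * g = wr_mul f g. Proof. by []. Qed.
Lemma wr_invE (f : wreath) : f^-1 = wr_inv f. Proof. by []. Qed.

End Wreath.

Definition wr_map (K L : groupType) (h : K -> L) (f : wreath K) : wreath L :=
  ((h f.1.1, h f.1.2), f.2).

Lemma wr_mapM (K L : groupType) (h : K -> L) :
  {morph h : f g / f * g} -> {morph wr_map h : f g / f * g}.
Proof.
move=> hM [[f0 f1] s] [[g0 g1] t].
by rewrite !wr_mulE /wr_map /wr_mul /=; case: t; rewrite /= !hM.
Qed.

Section Node.
Variable f : wreath treeAut.

Definition node_fun (w : seq bool) : seq bool :=
  if w is x :: w' then x (+) f.2 :: (if x then f.1.2 else f.1.1) w' else [::].

Definition node_inv_fun (w : seq bool) : seq bool :=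
  if w is x :: w' then
    x (+) f.2 :: taut_inv (if x (+) f.2 then f.1.2 else f.1.1) w'
  else [::].

Lemma node_funK : cancel node_fun node_inv_fun.
Proof. by case=> //= x w; rewrite -addbA addbb addbF tautK. Qed.

Lemma node_inv_funK : cancel node_inv_fun node_fun.
Proof. by case=> //= x w; rewrite -addbA addbb addbF taut_invK. Qed.

Lemma node_child w x : exists y, node_fun (rcons w x) = rcons (node_fun w) y.
Proof.
case: w => [|z w] /=; first by exists (x (+) f.2); rewrite taut_root.
by have [y ->] := taut_child (if z then f.1.2 else f.1.1) w x; exists y.
Qed.

Definition node : treeAut :=
  TreeAut node_funK node_inv_funK erefl node_child.

End Node.

Lemma nodeM : {morph node : f g / f * g}.
Proof.
move=> f g; rewrite wr_mulE; case: f g => [[f0 f1] s] [[g0 g1] t].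
apply: treeAutP => -[|x w] //=; rewrite addbCA addbC; congr cons.
by case: t; case: x.
Qed.

Definition fix_level n (g : treeAut) := forall w, size w = n -> g w = w.

Lemma fix_level_normal n : normal_pred (fix_level n).
Proof.
split=> [w|g h fg fh w sw|g fg w sw|g h fg w sw] //.
- by have := fg w sw; rewrite -{1}(fh w sw).
- by have := tautK g w; rewrite (fg w sw).
- by have := tautK h w; rewrite -(fg (h w)) // size_taut.
Qed.

Lemma fix_level_node n f g s :
  fix_level n.+1 (node ((f, g), s)) <->
  [/\ s = false, fix_level n f & fix_level n g].
Proof.
split=> [fix_fg|[-> ff fg] [|[] w] //= [sw]]; last 2 first.
- by rewrite fg.
- by rewrite ff.
have s0 : s = false.
  by have /= := fix_fg (nseq n.+1 false); rewrite size_nseq => /(_ erefl) [].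
split=> // w sw.
- by have /= := fix_fg (false :: w); rewrite sw s0 => /(_ erefl) [].
- by have /= := fix_fg (true :: w); rewrite sw s0 => /(_ erefl) [].
Qed.

(** * Fourth powers in a group generated by two involutions *)

Section Dihedral.
Variables (G : groupType) (p q : G).
Hypotheses (pp : p * p = 1) (qq : q * q = 1).

(** Powers of pq and of qp both occur because exponents are natural numbers and qp is the inverse of
    pq. *)
Definition dihedral_form (s : G) := exists (e : bool) k,
  s = p ^+ e * (p * q) ^+ k \/ s = p ^+ e * (q * p) ^+ k.

Let pK g : p * (p * g) = g. Proof. by rewrite mulgA pp mul1g. Qed.
Let qK g : q * (q * g) = g. Proof. by rewrite mulgA qq mul1g. Qed.

Lemma dihedral_form_mulp s : dihedral_form s -> dihedral_form (p * s).
Proof.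
case=> [] [] [k [->|->]]; rewrite /= ?expg1 ?expg0 ?mul1g ?pK.
- by exists false, k; left; rewrite mul1g.
- by exists false, k; right; rewrite mul1g.
- by exists true, k; left; rewrite expg1.
- by exists true, k; right; rewrite expg1.
Qed.

Lemma dihedral_form_mulq s : dihedral_form s -> dihedral_form (q * s).
Proof.
have e1 k : q * (p * q) ^+ k = p * (p * q) ^+ k.+1.
  by rewrite expgS !mulgA pp mul1g.
case=> [] [] [k [->|->]]; rewrite /= ?expg1 ?expg0 ?mul1g.
- case: k => [|k]; first by exists false, 1%N; right; rewrite expg0 mulg1 mul1g.
  by exists false, k; left; rewrite mul1g expgS -!mulgA pK qK.
- by exists false, k.+1; right; rewrite expgS !mulgA mul1g.
- by exists true, k.+1; left; rewrite expg1.
- case: k => [|k].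
    by exists true, 1%N; left; rewrite expg1 expg0 mulg1 pK.
  by exists true, k; right; rewrite expg1 expgS -!mulgA qK.
Qed.

Lemma eval_dihedral (I : Type) (x : I -> G) u :
  (forall i, [\/ x i = 1, x i = p | x i = q]) -> dihedral_form (eval_word x u).
Proof.
move=> xpq; elim: u => [|[i e] u IHu].
  by exists false, 0%N; left; rewrite eval_nil mulg1.
rewrite eval_cons /=.
have -> : (if e then (x i)^-1 else x i) = x i.
  by case: e => //; case: (xpq i) => ->; rewrite ?invg1 //; exact: mulg1_eq.
case: (xpq i) => ->; first by rewrite mul1g.
  exact: dihedral_form_mulp.
exact: dihedral_form_mulq.
Qed.

(** Reflections have trivial square, so their fourth power is covered by k = 0; for rotations the
    exponents 4 and k are exchanged. *)
Lemma dihedral_form_expg4 s : dihedral_form s ->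
  exists k, s ^+ 4 = ((p * q) ^+ 4) ^+ k \/ s ^+ 4 = ((q * p) ^+ 4) ^+ k.
Proof.
have inv k : (p * q) ^+ k * (q * p) ^+ k = 1.
  elim: k => [|k IHk]; first by rewrite mulg1.
  by rewrite expgSr expgS -!mulgA qK pK.
have inv' k : (q * p) ^+ k * (p * q) ^+ k = 1.
  elim: k => [|k IHk]; first by rewrite mulg1.
  by rewrite expgSr expgS -!mulgA pK qK.
have conj k : p * (p * q) ^+ k * p = (q * p) ^+ k.
  elim: k => [|k IHk]; first by rewrite mulg1.
  by rewrite !expgS -IHk -!mulgA !pK.
have conj' k : p * (q * p) ^+ k * p = (p * q) ^+ k.
  by rewrite -conj !mulgA pp mul1g -mulgA pp mulg1.
case=> [] [] [k [->|->]]; rewrite /= ?expg1 ?expg0 ?mul1g.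
- exists 0%N; left; rewrite !expgS expg0 mulg1.
  by rewrite !mulgA conj inv' mul1g conj inv'.
- exists 0%N; left; rewrite !expgS expg0 mulg1.
  by rewrite !mulgA conj' inv mul1g conj' inv.
- by exists k; left; rewrite expgnAC.
- by exists k; right; rewrite expgnAC.
Qed.

End Dihedral.

(** * The relators and the substitution sigma *)

Definition triple (G : groupType) (x y z : G) (i : 'I_3) : G :=
  nth 1 [:: x; y; z] i.

Lemma ord3P (P : 'I_3 -> Prop) : P ia -> P ib -> P ic -> forall i, P i.
Proof.
by move=> ? ? ? [[|[|[|//]]] h]; rewrite (bool_irrelevance h isT).
Qed.

(** These present the free product of a group of order 2, generated by a, and a Klein four-group,
    generated by b and c. *)
Definition klein_relators : seq (word 'I_3) :=
  [:: pow_word [:: (ia, false)] 2; pow_word [:: (ib, false)] 2;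
      pow_word [:: (ic, false)] 2; pow_word [:: (ib, false); (ic, false)] 2].

Definition higher_relators (n : nat) : seq (word 'I_3) :=
  [seq rel_u i | i <- iota 0 (n - 2)] ++ [seq rel_v i | i <- iota 0 (n - 3)]
  ++ [:: rel_w n; rel_t n].

Lemma grig_relatorsE n : grig_relators n = klein_relators ++ higher_relators n.
Proof. by []. Qed.

Lemma sigma_pow u k : sigma (pow_word u k) = pow_word (sigma u) k.
Proof. exact: hom_word_pow. Qed.

Lemma iter_sigma_pow i u k :
  iter i sigma (pow_word u k) = pow_word (iter i sigma u) k.
Proof. by elim: i => //= i ->; exact: sigma_pow. Qed.

Lemma higher_relatorsP n r : r \in higher_relators n ->
  [\/ exists2 i, (i < n - 2)%N & r = rel_u i,
      exists2 i, (i < n - 3)%N & r = rel_v i, r = rel_w n | r = rel_t n].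
Proof.
rewrite !mem_cat => /or3P[/mapP[i]|/mapP[i]|]; rewrite ?mem_iota ?inE.
- by move=> ilt ->; constructor 1; exists i.
- by move=> ilt ->; constructor 2; exists i.
- by case/orP=> /eqP ->; [constructor 3 | constructor 4].
Qed.

Lemma higher_relators_pow4 n r : r \in higher_relators n ->
  exists u, r = pow_word u 4.
Proof.
by case/higher_relatorsP=> [[i _]|[i _]||] ->; eexists; exact: iter_sigma_pow.
Qed.

Lemma mem_rel_u n i : (i < n - 2)%N -> rel_u i \in higher_relators n.
Proof. by move=> ?; rewrite mem_cat map_f // mem_iota. Qed.

Lemma mem_rel_v n i : (i < n - 3)%N -> rel_v i \in higher_relators n.
Proof. by move=> ?; rewrite !mem_cat map_f ?orbT // mem_iota. Qed.

Lemma mem_rel_w n : rel_w n \in higher_relators n.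
Proof. by rewrite !mem_cat inE eqxx !orbT. Qed.

Lemma mem_rel_t n : rel_t n \in higher_relators n.
Proof. by rewrite !mem_cat !inE eqxx !orbT. Qed.

Lemma rel_wS n : (3 <= n)%N -> rel_w n.+1 = sigma (rel_w n).
Proof. by move=> n3; rewrite /rel_w subSn. Qed.

Lemma rel_tS n : (3 <= n)%N -> rel_t n.+1 = sigma (rel_t n).
Proof. by move=> n3; rewrite /rel_t subSn. Qed.

Lemma higher_relators_sigma n r : (3 <= n)%N ->
  r \in higher_relators n -> sigma r \in higher_relators n.+1.
Proof.
move=> n3 /higher_relatorsP[[i ilt]|[i ilt]||] ->.
- by have := @mem_rel_u n.+1 i.+1; apply; rewrite subSn // ltnW.
- by have := @mem_rel_v n.+1 i.+1; apply; rewrite subSn.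
- by rewrite -rel_wS // mem_rel_w.
- by rewrite -rel_tS // mem_rel_t.
Qed.

(** The inductions on the level use this split: u_0 and v_0 are treated directly, and images under
    [sigma] through their sections. *)
Lemma higher_relators_succ n r : (3 <= n)%N -> r \in higher_relators n.+1 ->
  [\/ r = rel_u 0, r = rel_v 0
    | exists2 r', r' \in higher_relators n & r = sigma r'].
Proof.
move=> n3; have n2 := ltnW n3.
case/higher_relatorsP=> [[[|i]]|[[|i]]||];
  rewrite ?(subSn n3) ?(subSn n2).
- by move=> _ ->; constructor 1.
- by move=> ilt ->; constructor 3; exists (rel_u i); rewrite ?mem_rel_u.
- by move=> _ ->; constructor 2.
- by move=> ilt ->; constructor 3; exists (rel_v i); rewrite ?mem_rel_v.
- by move=> ->; constructor 3; exists (rel_w n); rewrite ?mem_rel_w ?rel_wS.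
- by move=> ->; constructor 3; exists (rel_t n); rewrite ?mem_rel_t ?rel_tS.
Qed.

Definition klein_gens (G : groupType) (x : 'I_3 -> G) :=
  [/\ x ia * x ia = 1, x ib * x ib = 1, x ic * x ic = 1
    & x ib * x ic * (x ib * x ic) = 1].

(* The sections of sigma(u) at 0 and 1 are theta(u) and u ([eval_psi_sigma]);
   [psi_gens] is the wreath recursion of the generators, where d = bc. *)
Section Generators.
Variables (G : groupType) (x : 'I_3 -> G).

Definition sigma_gens := triple (x ia * x ic * x ia) (x ib * x ic) (x ib).
Definition theta_gens := triple (x ib * x ic) 1 (x ia).
Definition psi_gens : 'I_3 -> wreath G :=
  triple (((1, 1), true) : wreath G) ((x ia, x ic), false)
    ((x ia, x ib * x ic), false).

Lemma klein_gensP :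
  klein_gens x <-> forall r, r \in klein_relators -> eval_word x r = 1.
Proof.
split=> [[ha hb hc hd] r|h].
  rewrite !inE => /or4P[]/eqP-> /=; rewrite !eval_cons eval_nil mulg1 //=.
  by rewrite mulgA.
have e k : (k < 4)%N -> eval_word x (nth [::] klein_relators k) = 1.
  by move=> k4; apply/h/mem_nth.
split; [have := e 0%N isT | have := e 1%N isT | have := e 2%N isT
  | have := e 3%N isT];
  by rewrite !eval_cons eval_nil mulg1 /= ?mulgA.
Qed.

Lemma eval_sigma u : eval_word x (sigma u) = eval_word sigma_gens u.
Proof.
rewrite [LHS](eval_hom_word x); apply: eq_eval.
by apply: ord3P; rewrite /= !eval_cons eval_nil mulg1 ?mulgA.
Qed.

Hypothesis xK : klein_gens x.

Lemma klein_commute : x ic * x ib = x ib * x ic.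
Proof.
have [_ bb cc dd] := xK; have := mulg1_eq dd; rewrite invgM.
by rewrite (mulg1_eq bb) (mulg1_eq cc).
Qed.

Lemma klein_sigma : klein_gens sigma_gens.
Proof.
have [aa bb cc dd] := xK.
have aK g : x ia * (x ia * g) = g by rewrite mulgA aa mul1g.
have bK g : x ib * (x ib * g) = g by rewrite mulgA bb mul1g.
have cK g : x ic * (x ic * g) = g by rewrite mulgA cc mul1g.
rewrite /klein_gens /sigma_gens /triple /=; split=> //.
  by rewrite -!mulgA !aK !cK aa.
by rewrite -klein_commute -!mulgA !(bK, cK) bb.
Qed.

Lemma klein_psi : klein_gens psi_gens.
Proof.
have [aa bb cc dd] := xK.
rewrite /klein_gens /psi_gens /triple /= !wr_mulE /wr_mul /=; split.
- by rewrite !mul1g.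
- by rewrite aa cc.
- by rewrite aa dd.
- have -> : x ic * (x ib * x ic) = x ib.
    by rewrite -klein_commute mulgA cc mul1g.
  by rewrite aa bb mulg1.
Qed.

Lemma eval_psi_sigma u : eval_word psi_gens (sigma u) =
  ((eval_word theta_gens u, eval_word x u), false).
Proof.
have [aa bb cc dd] := xK.
have {}cbc : x ic * (x ib * x ic) = x ib.
  by rewrite -klein_commute mulgA cc mul1g.
rewrite [LHS](eval_hom_word psi_gens).
have e (i : 'I_3) : eval_word psi_gens (nth [::]
      [:: [:: (ia, false); (ic, false); (ia, false)];
          [:: (ib, false); (ic, false)]; [:: (ib, false)]] i) =
    ((theta_gens i, x i), false).
  move: i; apply: ord3P; rewrite /= !eval_cons eval_nil /= mulg1
    /psi_gens /theta_gens /triple /= ?wr_mulE /wr_mul /= ?mulg1 ?mul1g //.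
  by rewrite aa cbc.
elim: u => [|[i s] u IHu]; first by rewrite !eval_nil.
by rewrite !eval_cons IHu /= e; case: s; rewrite ?wr_invE wr_mulE /wr_mul.
Qed.

End Generators.

Definition grig_autos : 'I_3 -> treeAut := triple aut_a aut_b aut_c.

Lemma aut_bc : aut_b * aut_c = aut_d.
Proof.
apply: treeAutP => w /=.
(* The three identities need a simultaneous induction, since the sections of b, c, d at the vertex 1
   are c, d, b. *)
have : [/\ fun_b (fun_c w) = fun_d w, fun_c (fun_d w) = fun_b w
  & fun_d (fun_b w) = fun_c w]; last by case.
elim: w => [//|[] w [bc cd db]] /=; last by rewrite fun_aK.
by rewrite cd db bc.
Qed.

Lemma klein_grig : klein_gens grig_autos.
Proof.
rewrite /grig_autos /triple /klein_gens /= aut_bc.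
by split; apply: treeAutP => w; [exact: fun_aK | exact: fun_bK
  | exact: fun_cK | exact: fun_dK].
Qed.

Lemma grig_node u :
  eval_word grig_autos u = node (eval_word (psi_gens grig_autos) u).
Proof.
rewrite (eval_morph _ _ nodeM); apply: eq_eval.
apply: ord3P; apply: treeAutP => -[|[] w];
  rewrite /= ?addbF ?addbT //=.
by rewrite -[fun_d w]/(aut_d w) -aut_bc.
Qed.

Lemma grig_sigma u : eval_word grig_autos (sigma u) =
  node ((eval_word (theta_gens grig_autos) u, eval_word grig_autos u), false).
Proof. by rewrite grig_node (eval_psi_sigma klein_grig). Qed.

(** * The presentation *)

Lemma involutions_commute (G : groupType) (p q : G) :
  p * p = 1 -> q * q = 1 -> (p * q) ^+ 2 = 1 -> commute p q.
Proof.
move=> /mulg1_eq pV /mulg1_eq qV; rewrite expgS expg1 => /mulg1_eq.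
by rewrite /commute invgM pV qV => ->.
Qed.

(** For words without inverse letters the action becomes an iteration of plain functions, which
    [vm_compute] can evaluate on all words of a given length. *)
Lemma eval_positive (x : 'I_3 -> treeAut) u w :
  all (fun l => ~~ l.2) u -> eval_word x u w = foldr (fun l => x l.1) w u.
Proof.
elim: u => [|[i []] u IHu] //=; first by rewrite eval_nil.
by move=> /IHu <-; rewrite eval_cons.
Qed.

Fixpoint bool_words k : seq (seq bool) :=
  if k is k'.+1 then
    map (cons false) (bool_words k') ++ map (cons true) (bool_words k')
  else [:: [::]].

Lemma mem_bool_words w : w \in bool_words (size w).
Proof.
elim: w => //= x w IHw; rewrite mem_cat.
by case: x; rewrite map_f ?orbT.
Qed.

Lemma aut_da_exp4 : (aut_d * aut_a) ^+ 4 = 1.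
Proof.
by rewrite !expgS expg0 mulg1; apply: treeAutP => -[|[] w] //=; rewrite !fun_bK.
Qed.

Lemma aut_ad_exp4 : (aut_a * aut_d) ^+ 4 = 1.
Proof.
by rewrite !expgS expg0 mulg1; apply: treeAutP => -[|[] w] //=; rewrite !fun_bK.
Qed.

Lemma grig_rel_u0 : eval_word grig_autos (rel_u 0) = 1.
Proof.
by rewrite eval_pow !eval_cons eval_nil mulg1 /grig_autos /triple /= aut_bc
  aut_ad_exp4.
Qed.

Lemma grig_rel_v0 : eval_word grig_autos (rel_v 0) = 1.
Proof.
rewrite eval_pow !eval_cons eval_nil mulg1 /grig_autos /triple /=.
rewrite (mulgA aut_b) aut_bc !expgS expg0 mulg1.
by apply: treeAutP => -[|[] w] //=; rewrite !(fun_aK, fun_bK, fun_dK).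
Qed.

(** The values of theta lie in the group generated by the involutions d and a, where (da)^4 = (ad)^4
    = 1, and the higher relators are fourth powers. *)
Lemma theta_grig_relators n r : r \in grig_relators n ->
  eval_word (theta_gens grig_autos) r = 1.
Proof.
have dd : aut_d * aut_d = 1 by apply: treeAutP => w; exact: fun_dK.
have aa : aut_a * aut_a = 1 by apply: treeAutP => w; exact: fun_aK.
rewrite grig_relatorsE mem_cat => /orP[|/higher_relators_pow4[u ->]].
  move: r; apply/klein_gensP; rewrite /theta_gens /triple /klein_gens /=.
  by rewrite aut_bc !mul1g aa dd.
rewrite eval_pow; have [|k [] ->] := dihedral_form_expg4 dd aa
    (eval_dihedral (x := theta_gens grig_autos) dd aa u _).
- by apply: ord3P; rewrite /theta_gens /= /triple /= ?aut_bc;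
    [constructor 2 | constructor 1 | constructor 3].
- by rewrite aut_da_exp4 expg1n.
- by rewrite aut_ad_exp4 expg1n.
Qed.

(** For n = 3 the action of w_3 and t_3 is computed. In the step, sigma(r) has the section theta(r)
    = 1 at 0 and the section r at 1. *)
Lemma grig_relators_fix n r : (3 <= n)%N -> r \in grig_relators n ->
  fix_level n (eval_word grig_autos r).
Proof.
move=> n3; rewrite grig_relatorsE mem_cat => /orP[|].
  by move: r; have /klein_gensP h := klein_grig => r /h ->.
elim: n n3 r => // n IHn; rewrite leq_eqVlt => /predU1P[[<-]|n3] r.
  case/higher_relatorsP=> [[[|//] _]|[]//||] ->.
  - by rewrite grig_rel_u0.
  - move=> w sw; rewrite eval_positive //; apply/eqP.
    move: w (mem_bool_words w) sw => w + sw; rewrite sw; move: w {sw}.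
    by apply/allP; vm_compute.
  - move=> w sw; rewrite eval_positive //; apply/eqP.
    move: w (mem_bool_words w) sw => w + sw; rewrite sw; move: w {sw}.
    by apply/allP; vm_compute.
case/(higher_relators_succ n3)=> [->|->|[r' hr' ->]].
- by rewrite grig_rel_u0.
- by rewrite grig_rel_v0.
- rewrite grig_sigma; apply/fix_level_node; split=> //; last exact: IHn.
  by rewrite (@theta_grig_relators n) // grig_relatorsE mem_cat hr' orbT.
Qed.

Lemma ncl_fix_level n u : (3 <= n)%N -> normal_closure (grig_relators n) u ->
  fix_level n (eval_word grig_autos u).
Proof.
move=> n3; apply: ncl_eval; first exact: fix_level_normal.
by move=> r; exact: grig_relators_fix.
Qed.

(** * Decomposition of words modulo the relators *)

Section Decomposition.
Variables (K : groupType) (x : 'I_3 -> K).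
Hypothesis xK : klein_gens x.
Variables a c d c' d' : K.
Hypotheses (aE : a = x ia) (cE : c = x ic) (dE : d = x ib * x ic).
Hypotheses (c'E : c' = a * c * a) (d'E : d' = a * d * a).
Hypotheses (dd' : commute d' d) (dd'cc : commute d' (d ^ (c' * c))).
Hypothesis cc'4 : (c * c') ^+ 4 = 1.

Local Notation S := (eval_word (sigma_gens x)).

Let aa : a * a = 1. Proof. by rewrite aE; case: xK. Qed.
Let cc : c * c = 1. Proof. by rewrite cE; case: xK. Qed.
Let dd : d * d = 1. Proof. by rewrite dE; case: xK. Qed.
Let aK g : a * (a * g) = g. Proof. by rewrite mulgA aa mul1g. Qed.
Let cK g : c * (c * g) = g. Proof. by rewrite mulgA cc mul1g. Qed.
Let cd : commute c d.
Proof. by rewrite /commute dE cE mulgA (klein_commute xK). Qed.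
Let b_cd : x ib = c * d.
Proof. by rewrite cd dE -mulgA -cE cc mulg1. Qed.
Let c'c' : c' * c' = 1. Proof. by rewrite c'E -!mulgA aK cK aa. Qed.
Let c'd' : commute d' c'.
Proof. by rewrite /commute c'E d'E -!mulgA !aK (mulgA d) -cd -mulgA. Qed.

Lemma commute_conj (p q r : K) :
  commute p r -> commute p q -> commute p (q ^ r).
Proof.
by move=> pr pq; apply: commuteM; [exact: commuteV | exact: commuteM].
Qed.

(** By [cc'4] the products c'^e (cc')^i run through the whole dihedral group generated by c and c',
    so this says that d' commutes with all conjugates of z under that group. *)
Let centr z := forall (e : bool) i, commute d' (z ^ (c' ^+ e * (c * c') ^+ i)).

Lemma centr_conjc' z : centr z -> centr (z ^ c').
Proof.
move=> h e i; rewrite -conjgM mulgA; case: e; rewrite ?expg1 ?expg0 ?mulg1.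
  by rewrite c'c'; exact: (h false).
exact: (h true).
Qed.

Lemma centr_conjc z : centr z -> centr (z ^ c).
Proof.
move=> h e i; rewrite -conjgM; case: e; rewrite /= ?expg1 ?expg0 ?mul1g.
  by rewrite mulgA -expgS -[_ ^+ _]mul1g; exact: (h false).
case: i => [|i]; last by rewrite expgS -(mulgA c) cK; exact: (h true).
suff -> : c * (c * c') ^+ 0 = c' ^+ true * (c * c') ^+ 3 by exact: h.
by rewrite mulg1 /= expg1; rewrite -[LHS]mulg1 -cc'4 expgS -(mulgA c) cK.
Qed.

(** As d commutes with c, only its conjugates by (cc')^i with i < 4 matter. Since d' commutes with
    c', the cases i = 1 and i = 2 follow from [dd'] and [dd'cc] by conjugating with c'; the case i =
    3 is [dd'cc] itself, because (cc')^3 = c'c. *)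
Lemma centr_d : centr d.
Proof.
have dc : d ^ c = d by rewrite /conjg -cd mulKg.
have d'c' z : commute d' z -> commute d' (z ^ c') by exact: commute_conj.
have c2 : commute d' (d ^ (c * c') ^+ 2).
  have -> : (c * c') ^+ 2 = c * (c' * c * c') by rewrite expgS expg1 !mulgA.
  rewrite conjgM dc conjgM.
  exact: d'c'.
have c3 : commute d' (d ^ (c * c') ^+ 3).
  have -> : (c * c') ^+ 3 = c' * c; last by [].
  apply: invg_inj; rewrite (invgM c' c) (mulg1_eq cc) (mulg1_eq c'c').
  by apply: mulg1_eq; rewrite -expgSr.
have ci i : commute d' (d ^ (c * c') ^+ i).
  elim/ltn_ind: i => -[|[|[|[|i]]]] IHi //; first by rewrite conjg1.
    by rewrite expg1 conjgM dc; exact: d'c'.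
  rewrite -add4n expgnDr cc'4 mul1g; apply: IHi.
  by rewrite -addn4 -addn1 leq_add2l.
case=> i /=; last by rewrite mul1g.
by rewrite -[d in d ^ _]dc -conjgM mulgA -expgS.
Qed.

(** The images of a, b, c under sigma are c', d and b = cd. Conjugation by c and c' only permutes
    the conditions in [centr], and z^d is a product of elements satisfying [centr], d being one of
    them. *)
Lemma centr_conj_sigma z u : centr z -> centr (z ^ S u).
Proof.
have cM y y' : centr y -> centr y' -> centr (y * y').
  by move=> hy hy' e i; rewrite conjMg; exact: commuteM.
have cV y : centr y -> centr y^-1.
  by move=> hy e i; rewrite conjVg; exact: commuteV.
have conj_d z' : centr z' -> centr (z' ^ d).
  by move=> hz; apply: (cM _ _ (cV _ centr_d)); apply: cM => //; exact: centr_d.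
elim: u z => [|[i s] u IHu] z hz; first by rewrite eval_nil conjg1.
rewrite eval_cons conjgM; apply: IHu => {u}.
have -> : (if s then (sigma_gens x i)^-1 else sigma_gens x i) = sigma_gens x i.
  case: s => //=; apply: mulg1_eq.
  by have [ha hb hc _] := klein_sigma xK; move: i; apply: ord3P.
move: i; apply: ord3P; rewrite /sigma_gens /triple /= -?dE -?aE -?cE -?c'E.
- exact: centr_conjc'.
- exact: conj_d.
- by rewrite b_cd conjgM; apply/conj_d/centr_conjc.
Qed.

(** This holds for b and is stable under products and conjugation, hence it holds for all products
    of conjugates of b. *)
Definition theta_kernel y := eval_word (theta_gens grig_autos) y = 1 /\
  forall k, commute d' (S y ^ S k).

Lemma theta_kernel_nil : theta_kernel [::].
Proof. by split=> [|k]; rewrite !eval_nil ?conj1g //; exact: commute1. Qed.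

Lemma theta_kernel_b : theta_kernel [:: (ib, false)].
Proof.
split=> [|k]; first by rewrite eval_cons eval_nil !mul1g.
rewrite eval_cons eval_nil mulg1; have := centr_conj_sigma k centr_d.
by move=> /(_ false 0%N); rewrite mul1g conjg1 dE.
Qed.

Lemma theta_kernel_cat y z :
  theta_kernel y -> theta_kernel z -> theta_kernel (y ++ z).
Proof.
move=> [y1 cy] [z1 cz]; split=> [|k]; first by rewrite eval_cat y1 z1 mulg1.
by rewrite eval_cat conjMg; exact: commuteM.
Qed.

Lemma theta_kernel_conj y g :
  theta_kernel y -> theta_kernel (inv_word g ++ y ++ g).
Proof.
move=> [y1 cy]; split=> [|k].
  by rewrite !eval_cat eval_inv y1 mul1g mulVg.
by rewrite !eval_cat eval_inv -conjgE -conjgM -eval_cat.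
Qed.

(** On the tree a sigma(y) a has the sections y and theta(y) = 1, whereas sigma(k) has theta(k) and
    k. This lets a condition on the product be read as conditions on y and k. *)
Definition normal_form g := exists (e : bool) y k, theta_kernel y /\
  g = a ^+ e * (a * S y * a * S k).

Let Sa : S [:: (ia, false)] = c'.
Proof. by rewrite eval_cons eval_nil mulg1 c'E aE cE. Qed.
Let Sb : S [:: (ib, false)] = d.
Proof. by rewrite eval_cons eval_nil mulg1 dE. Qed.
Let Sbc : S [:: (ib, false); (ic, false)] = c.
Proof.
rewrite !eval_cons eval_nil mulg1 /sigma_gens /triple /= -dE b_cd.
by rewrite mulgA -cd -mulgA dd mulg1.
Qed.
Lemma normal_form_a g : normal_form g -> normal_form (a * g).
Proof.
move=> [[] [y [k [ky ->]]]].
  by exists false, y, k; rewrite expg1 mul1g aK.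
by exists true, y, k; rewrite mul1g expg1.
Qed.

Let even_form g := exists y k, theta_kernel y /\ g = a * S y * a * S k.

(** Moving c past a sigma(y) a conjugates sigma(y) by aca = c' = sigma(a); then c = sigma(bc) joins
    sigma(k). For c' the roles of c and c' are exchanged. *)
Let even_form_c g : even_form g -> even_form (c * g).
Proof.
move=> [y [k [ky ->]]].
exists (inv_word [:: (ia, false)] ++ y ++ [:: (ia, false)]).
exists ([:: (ib, false); (ic, false)] ++ k).
split; first exact: theta_kernel_conj.
by rewrite !eval_cat eval_inv Sa Sbc (mulg1_eq c'c') c'E -!mulgA !aK cK.
Qed.

Let even_form_c' g : even_form g -> even_form (c' * g).
Proof.
move=> [y [k [ky ->]]]; set bc := [:: (ib, false); (ic, false)].
exists (inv_word bc ++ y ++ bc), ((ia, false) :: k).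
split; first exact: theta_kernel_conj.
rewrite -cat1s !eval_cat eval_inv Sa Sbc (mulg1_eq cc) c'E.
by rewrite -!mulgA !aK cK.
Qed.

(** Since d' commutes with sigma(y), its conjugate d commutes with a sigma(y) a and can join
    sigma(k) as sigma(b). *)
Let even_form_d g : even_form g -> even_form (d * g).
Proof.
move=> [y [k [ky ->]]]; exists y, ((ib, false) :: k); split=> //.
rewrite -cat1s eval_cat Sb -!mulgA.
case: ky => _ /(_ [::]); rewrite eval_nil conjg1 => yd'.
have da : d * a = a * d' by rewrite d'E -!mulgA aK.
have ad : d' * a = a * d by rewrite d'E -!mulgA aa mulg1.
by rewrite (mulgA d) da -mulgA (mulgA d') yd' -mulgA (mulgA d') ad -mulgA.
Qed.

Let even_form_d' g : even_form g -> even_form (d' * g).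
Proof.
move=> [y [k [ky ->]]]; exists ([:: (ib, false)] ++ y), k.
split; first exact: theta_kernel_cat theta_kernel_b ky.
by rewrite eval_cat Sb d'E -!mulgA aK.
Qed.

Let normal_formP g : normal_form g <-> even_form g \/ even_form (a * g).
Proof.
split=> [[[] [y [k [ky ->]]]]|[|] [y [k [ky e]]]].
- by right; exists y, k; rewrite expg1 aK.
- by left; exists y, k; rewrite mul1g.
- by exists false, y, k; rewrite mul1g.
- by exists true, y, k; rewrite expg1 -e aK.
Qed.

Lemma normal_form_eval u : normal_form (eval_word x u).
Proof.
have ac g : a * (c * g) = c' * (a * g) by rewrite c'E -!mulgA aK.
have ad g : a * (d * g) = d' * (a * g) by rewrite d'E -!mulgA aK.
have form_c g : normal_form g -> normal_form (c * g).
  by move=> /normal_formP[h|h]; apply/normal_formP;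
    [left; exact: even_form_c | right; rewrite ac; exact: even_form_c'].
have form_d g : normal_form g -> normal_form (d * g).
  by move=> /normal_formP[h|h]; apply/normal_formP;
    [left; exact: even_form_d | right; rewrite ad; exact: even_form_d'].
elim: u => [|[i s] u IHu].
  rewrite eval_nil; exists false, [::], [::].
  split; first exact: theta_kernel_nil.
  by rewrite eval_nil !mulg1 mul1g aa.
rewrite eval_cons /=.
have -> : (if s then (x i)^-1 else x i) = x i.
  case: s => //; apply: mulg1_eq.
  by have [ha hb hc _] := xK; move: i; apply: ord3P.
move: i; apply: ord3P.
- by rewrite -aE; exact: normal_form_a.
- by rewrite b_cd -mulgA; exact/form_c/form_d.
- by rewrite -cE; exact: form_c.
Qed.

End Decomposition.

Lemma aut_a_node : aut_a = node (((1, 1), true) : wreath treeAut).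
Proof. by apply: treeAutP => -[|x w] //=; rewrite addbT; case: x. Qed.

Lemma rel_u0_eval (G : groupType) (x : 'I_3 -> G) :
  eval_word x (rel_u 0) = (x ia * (x ib * x ic)) ^+ 4.
Proof. by rewrite eval_pow !eval_cons eval_nil mulg1. Qed.

Lemma level_ncl_step n : (3 <= n)%N ->
    (forall u, fix_level n (eval_word grig_autos u) ->
      normal_closure (grig_relators n) u) ->
  forall u, fix_level n.+1 (eval_word grig_autos u) ->
    normal_closure (grig_relators n.+1) u.
Proof.
move=> n3 IHn u fix_u; have n2 := ltnW n3.
set x := pres_gen (grig_relators n.+1).
have xR r : r \in grig_relators n.+1 -> eval_word x r = 1.
  exact: eval_pres_gen_relator.
have xH r : r \in higher_relators n.+1 -> eval_word x r = 1.
  by move=> hr; rewrite xR // grig_relatorsE mem_cat hr orbT.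
have xK : klein_gens x.
  by apply/klein_gensP => r hr; rewrite xR // grig_relatorsE mem_cat hr.
have sigmaR v :
    normal_closure (grig_relators n) v -> eval_word (sigma_gens x) v = 1.
  apply: (ncl_eval (@normal_pred_trivial _)) => r.
  rewrite grig_relatorsE mem_cat => /orP[|hr].
    by move: r; apply/klein_gensP; exact: klein_sigma.
  by rewrite -eval_sigma xH // higher_relators_sigma.
(* The abbreviations are opaque variables with equations, so that rewriting decides where they are
   unfolded. *)
have [[a aE] [c cE] [d dE]] :
    [/\ exists a, a = x ia, exists c, c = x ic & exists d, d = x ib * x ic].
  by split; eexists.
have [[c' c'E] [d' d'E]] :
  (exists c', c' = a * c * a) /\ (exists d', d' = a * d * a) by split; eexists.
have [aa bb cc dd] := xK; rewrite -?dE -?aE -?cE in aa cc dd.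
have aK g : a * (a * g) = g by rewrite mulgA aa mul1g.
have cK g : c * (c * g) = g by rewrite mulgA cc mul1g.
have d'd' : d' * d' = 1 by rewrite d'E -!mulgA aK (mulgA d) dd mul1g.
have c'c' : c' * c' = 1 by rewrite c'E -!mulgA aK cK.
have dd' : commute d' d.
  apply: involutions_commute => //.
  have <- : eval_word x (rel_u 0) = 1 by rewrite xH // mem_rel_u // subSn.
  have -> : d' * d = (a * d) ^+ 2 by rewrite expg2 d'E !mulgA.
  by rewrite -expgnA rel_u0_eval -dE -aE.
(* The square of abcacac = adacac is d' d^(c'c), so v_0 is the square of a product of two
   involutions. *)
have dd'cc : commute d' (d ^ (c' * c)).
  apply: involutions_commute => //; first by rewrite -conjMg dd conj1g.
  have <- : eval_word x (rel_v 0) = 1.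
    by rewrite xH // mem_rel_v // subSn // subn_gt0.
  rewrite eval_pow !eval_cons eval_nil mulg1 /= (mulgA (x ib)) -dE -aE -cE.
  rewrite (expgnA _ 2 2) [X in _ = X ^+ 2]expg2 /conjg invgM.
  by rewrite (mulg1_eq cc) (mulg1_eq c'c') d'E c'E !mulgA.
(* Since bcb = c, the word u_1 = (aca.bc.b)^4 equals (c'c)^4. *)
have cc'4 : (c * c') ^+ 4 = 1.
  have c'c4 : (c' * c) ^+ 4 = 1.
    have <- : eval_word x (rel_u 1) = 1.
      by rewrite xH // mem_rel_u // subSn // ltnS subn_gt0.
    rewrite (eval_sigma x (rel_u 0)) rel_u0_eval /sigma_gens /triple /=.
    rewrite -(mulgA (x ib)) (klein_commute xK) (mulgA (x ib)) bb mul1g.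
    by rewrite c'E aE cE.
  have -> : c * c' = (c' * c)^-1.
    by rewrite invgM (mulg1_eq cc) (mulg1_eq c'c').
  by rewrite expVgn c'c4 invg1.
have [e [y [k [[ty _] uE]]]] :=
  normal_form_eval xK aE cE dE c'E d'E dd' dd'cc cc'4 u.
pose A := [:: (ia, false)] : word 'I_3.
pose w := pow_word A e ++ A ++ sigma y ++ A ++ sigma k.
have A_eval (G : groupType) (z : 'I_3 -> G) : eval_word z A = z ia.
  by rewrite eval_cons eval_nil mulg1.
have uw : normal_closure (grig_relators n.+1) (inv_word u ++ w).
  apply/eval_pres_gen_eq1; rewrite !eval_cat eval_inv -/x uE.
  by rewrite !A_eval eval_pow A_eval !eval_sigma -aE -!mulgA mulVg.
have fix_w : fix_level n.+1 (eval_word grig_autos w).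
  have := ncl_fix_level (leqW n3) uw; rewrite eval_cat eval_inv => fix_uw.
  have [_ fM _ _] := fix_level_normal n.+1.
  by have := fM _ _ fix_u fix_uw; rewrite mulVKg.
(* If e = 1 the first level is moved; otherwise the sections of w at 0 and 1 are y theta(k) and
   k. *)
have [{}e0 fix_y fix_k] : [/\ e = false,
    fix_level n (eval_word grig_autos y * eval_word (theta_gens grig_autos) k)
  & fix_level n (eval_word grig_autos k)].
  move: fix_w; rewrite /w !eval_cat eval_pow !A_eval !grig_sigma ty.
  rewrite [grig_autos ia]aut_a_node; case: e {uE w uw} => /=.
    rewrite expg1 -!nodeM !wr_mulE /wr_mul /= => /fix_level_node[] //.
  rewrite mul1g -!nodeM !wr_mulE /wr_mul /= !mul1g => /fix_level_node[_ h1 h2].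
  by split.
have nk := IHn _ fix_k.
have tk : eval_word (theta_gens grig_autos) k = 1.
  have := ncl_eval (@normal_pred_trivial _) _ nk; apply.
  exact: theta_grig_relators.
rewrite tk mulg1 in fix_y.
apply/eval_pres_gen_eq1; rewrite -/x uE e0 mul1g.
by rewrite (sigmaR _ nk) (sigmaR _ (IHn _ fix_y)) !mulg1.
Qed.

(** * Normal forms for level 3 *)

Section BaseLevel.
Variables (K : groupType) (x : 'I_3 -> K).
Hypothesis xK : klein_gens x.
Variables a c d c' d' f f' : K.
Hypotheses (aE : a = x ia) (cE : c = x ic) (dE : d = x ib * x ic).
Hypotheses (c'E : c' = a * c * a) (d'E : d' = a * d * a).
Hypotheses (fE : f = c' * d * c') (f'E : f' = c * d' * c).
Hypotheses (dd' : commute d d') (cc' : commute c c') (d'f' : commute d' f').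

Let aa : a * a = 1. Proof. by rewrite aE; case: xK. Qed.
Let cc : c * c = 1. Proof. by rewrite cE; case: xK. Qed.
Let dd : d * d = 1. Proof. by rewrite dE; case: xK. Qed.
Let aK g : a * (a * g) = g. Proof. by rewrite mulgA aa mul1g. Qed.
Let cK g : c * (c * g) = g. Proof. by rewrite mulgA cc mul1g. Qed.
Let dK g : d * (d * g) = g. Proof. by rewrite mulgA dd mul1g. Qed.
Let cd : commute c d.
Proof. by rewrite /commute dE cE mulgA (klein_commute xK). Qed.
Let b_cd : x ib = c * d.
Proof. by rewrite cd dE -mulgA -cE cc mulg1. Qed.
Let c'c' : c' * c' = 1. Proof. by rewrite c'E -!mulgA aK cK aa. Qed.
Let c'K g : c' * (c' * g) = g. Proof. by rewrite mulgA c'c' mul1g. Qed.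
Let c'd' : commute c' d'.
Proof. by rewrite /commute c'E d'E -!mulgA !aK (mulgA c) cd -mulgA. Qed.
Let d'd' : d' * d' = 1. Proof. by rewrite d'E -!mulgA aK dK aa. Qed.

Let cd' : c * d' = f' * c. Proof. by rewrite f'E -!mulgA cc mulg1. Qed.
Let cf' : c * f' = d' * c. Proof. by rewrite f'E -!mulgA cK. Qed.
Let c'd : c' * d = f * c'. Proof. by rewrite fE -!mulgA c'c' mulg1. Qed.
Let c'f : c' * f = d * c'. Proof. by rewrite fE -!mulgA c'K. Qed.
Let cf : commute c f.
Proof.
by rewrite /commute fE !mulgA cc' -(mulgA c') cd -!mulgA cc'.
Qed.
Let c'f' : commute c' f'.
Proof.
by rewrite /commute f'E !mulgA -cc' -(mulgA c) c'd' -!mulgA -cc'.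
Qed.
Let d'f : commute d' f.
Proof.
apply: commute_sym; rewrite /commute fE -!mulgA c'd' (mulgA d) dd' -mulgA.
by rewrite (mulgA c') c'd' -!mulgA.
Qed.
Let af : a * f = f' * a.
Proof. by rewrite fE f'E d'E c'E -!mulgA !aK. Qed.
Let df : commute d f.
Proof.
have <- : a * f' * a = f by rewrite -(mulgA a) -af aK.
have -> : d = a * d' * a by rewrite d'E -!mulgA aK aa mulg1.
by rewrite /commute -!mulgA !aK (mulgA d') d'f' -mulgA.
Qed.

(** These are the 128 words a^e d^i f^j d'^k f'^l c^m c'^q. Here c fixes d and f and exchanges d'
    and f' by conjugation, c' fixes d' and f' and exchanges d and f, and a exchanges each letter
    with its primed form. *)
Definition normal_word (e i j k l m q : bool) : word 'I_3 :=
  let A := [:: (ia, false)] in let C := [:: (ic, false)] in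
  let D := [:: (ib, false); (ic, false)] in
  let C' := A ++ C ++ A in let D' := A ++ D ++ A in
  pow_word A e ++ pow_word D i ++ pow_word (C' ++ D ++ C') j ++ pow_word D' k
  ++ pow_word (C ++ D' ++ C) l ++ pow_word C m ++ pow_word C' q.

Let even_word (i j k l m q : bool) :=
  d ^+ i * (f ^+ j * (d' ^+ k * (f' ^+ l * (c ^+ m * c' ^+ q)))).

Let normal_word_eval e i j k l m q :
  eval_word x (normal_word e i j k l m q) = a ^+ e * even_word i j k l m q.
Proof.
rewrite /normal_word !eval_cat !eval_pow !eval_cat !eval_cons !eval_nil.
rewrite !mulg1 /=.
by rewrite -dE -aE -cE /even_word !mulgA fE f'E d'E c'E !mulgA.
Qed.

Let mulX (p q r : K) (h : bool) g :
  p * q = r * p -> p * (q ^+ h * g) = r ^+ h * (p * g).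
Proof. by case: h; rewrite ?mul1g // !expg1 !mulgA => ->. Qed.

Let mulXK (p : K) (h : bool) g :
  p * p = 1 -> p * (p ^+ h * g) = p ^+ (~~ h) * g.
Proof. by case: h => pp; rewrite /= ?mul1g ?expg1 // mulgA pp mul1g. Qed.

Let even_word_c i j k l m q :
  c * even_word i j k l m q = even_word i j l k (~~ m) q.
Proof.
rewrite /even_word (mulX _ _ cd) (mulX _ _ cf) (mulX _ _ cd') (mulX _ _ cf').
rewrite mulXK //; congr (_ * (_ * _)); rewrite !mulgA; congr (_ * _ * _).
by apply: commuteX2; exact: commute_sym.
Qed.

Let even_word_c' i j k l m q :
  c' * even_word i j k l m q = even_word j i k l m (~~ q).
Proof.
rewrite /even_word (mulX _ _ c'd) (mulX _ _ c'f) (mulX _ _ c'd').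
rewrite (mulX _ _ c'f') (mulX _ _ (commute_sym cc')) -[c' ^+ q]mulg1.
rewrite mulXK // mulg1.
by rewrite !mulgA; do 4![congr (_ * _)]; apply: commuteX2; exact: commute_sym.
Qed.

Let even_word_d i j k l m q :
  d * even_word i j k l m q = even_word (~~ i) j k l m q.
Proof. exact: mulXK. Qed.

Let even_word_d' i j k l m q :
  d' * even_word i j k l m q = even_word i j (~~ k) l m q.
Proof.
by rewrite /even_word (mulX _ _ (commute_sym dd')) (mulX _ _ d'f) mulXK.
Qed.

Let normal g := exists (e i j k l m q : bool),
  g = a ^+ e * even_word i j k l m q.

Let normal_a g : normal g -> normal (a * g).
Proof.
move=> [e [i [j [k [l [m [q ->]]]]]]]; exists (~~ e), i, j, k, l, m, q.
by rewrite mulXK.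
Qed.

Let normal_c g : normal g -> normal (c * g).
Proof.
move=> [[] [i [j [k [l [m [q ->]]]]]]].
  exists true, j, i, k, l, m, (~~ q); rewrite -even_word_c' expg1 c'E.
  by rewrite -!mulgA !aK.
by exists false, i, j, l, k, (~~ m), q; rewrite -even_word_c !mul1g.
Qed.

Let normal_d g : normal g -> normal (d * g).
Proof.
move=> [[] [i [j [k [l [m [q ->]]]]]]].
  exists true, i, j, (~~ k), l, m, q; rewrite -even_word_d' expg1 d'E.
  by rewrite -!mulgA !aK.
by exists false, (~~ i), j, k, l, m, q; rewrite -even_word_d !mul1g.
Qed.

Lemma normal_word_exists u : exists e i j k l m q,
  eval_word x u = eval_word x (normal_word e i j k l m q).
Proof.
suff [e [i [j [k [l [m [q ->]]]]]]] : normal (eval_word x u).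
  by exists e, i, j, k, l, m, q; rewrite normal_word_eval.
elim: u => [|[s t] u IHu].
  exists false, false, false, false, false, false, false.
  by rewrite eval_nil /even_word !mulg1.
rewrite eval_cons /=.
have -> : (if t then (x s)^-1 else x s) = x s.
  case: t => //; apply: mulg1_eq.
  by have [ha hb hc _] := xK; move: s; apply: ord3P.
move: s; apply: ord3P.
- by rewrite -aE; exact: normal_a.
- by rewrite b_cd -mulgA; exact/normal_c/normal_d.
- by rewrite -cE; exact: normal_c.
Qed.

End BaseLevel.

(** The action of each of the 128 words on the words of length 3 is computed. *)
Lemma normal_word_trivial e i j k l m q :
    fix_level 3 (eval_word grig_autos (normal_word e i j k l m q)) ->
  normal_word e i j k l m q = [::].
Proof.
move=> fix_w; have : all (fun w => foldr (fun l => grig_autos l.1) w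
    (normal_word e i j k l m q) == w) (bool_words 3).
  apply/allP => w w3; rewrite -eval_positive ?fix_w //.
    by apply/eqP; move: w w3; apply/allP.
  by move: e i j k l m q {fix_w}; do 7!case.
by move: e i j k l m q {fix_w}; do 7!case; vm_compute.
Qed.

Lemma level_ncl3 u : fix_level 3 (eval_word grig_autos u) ->
  normal_closure (grig_relators 3) u.
Proof.
move=> fix_u; set x := pres_gen (grig_relators 3).
have xR r : r \in grig_relators 3 -> eval_word x r = 1.
  exact: eval_pres_gen_relator.
have xH r : r \in higher_relators 3 -> eval_word x r = 1.
  by move=> hr; rewrite xR // grig_relatorsE mem_cat hr orbT.
have xK : klein_gens x.
  by apply/klein_gensP => r hr; rewrite xR // grig_relatorsE mem_cat hr.
have [[a aE] [c cE] [d dE]] :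
    [/\ exists a, a = x ia, exists c, c = x ic & exists d, d = x ib * x ic].
  by split; eexists.
have [[c' c'E] [d' d'E]] :
  (exists c', c' = a * c * a) /\ (exists d', d' = a * d * a) by split; eexists.
have [[f fE] [f' f'E]] :
    (exists f, f = c' * d * c') /\ (exists f', f' = c * d' * c).
  by split; eexists.
have [aa bb cc dd] := xK; rewrite -?dE -?aE -?cE in aa cc dd.
have aK g : a * (a * g) = g by rewrite mulgA aa mul1g.
have cK g : c * (c * g) = g by rewrite mulgA cc mul1g.
have dK g : d * (d * g) = g by rewrite mulgA dd mul1g.
have d'd' : d' * d' = 1 by rewrite d'E -!mulgA aK dK aa.
have c'c' : c' * c' = 1 by rewrite c'E -!mulgA aK cK.
have f'f' : f' * f' = 1 by rewrite f'E -!mulgA cK (mulgA d') d'd' mul1g.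
have dd' : commute d d'.
  apply: commute_sym; apply: involutions_commute => //.
  have <- : eval_word x (rel_u 0) = 1 by rewrite xH // mem_rel_u.
  have -> : d' * d = (a * d) ^+ 2 by rewrite expg2 d'E !mulgA.
  by rewrite -expgnA rel_u0_eval -dE -aE.
have cc' : commute c c'.
  apply: commute_sym; apply: involutions_commute => //.
  have <- : eval_word x (rel_w 3) = 1 by rewrite xH // mem_rel_w.
  rewrite eval_pow !eval_cons eval_nil mulg1 /= -aE -cE (expgnA _ 2 2).
  by rewrite [X in _ = X ^+ 2]expg2 c'E !mulgA.
(* Here abac = d'c'c, and as c' commutes with c and d' its square is d'f'; thus t_3 = (d'f')^2. *)
have d'f' : commute d' f'.
  apply: involutions_commute => //.
  have <- : eval_word x (rel_t 3) = 1 by rewrite xH // mem_rel_t.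
  rewrite eval_pow !eval_cons eval_nil mulg1 /= -aE -cE (expgnA _ 2 2).
  rewrite [X in _ = X ^+ 2]expg2; congr (_ ^+ 2).
  have -> : x ib = d * c by rewrite dE cE -mulgA -cE cc mulg1.
  have -> : a * (d * c * (a * c)) = d' * (c' * c).
    by rewrite d'E c'E -!mulgA !aK.
  rewrite f'E -!mulgA; congr (d' * _).
  have c'd' : c' * d' = d' * c'.
    have cd : c * d = d * c by rewrite dE cE mulgA (klein_commute xK).
    by rewrite c'E d'E -!mulgA !aK (mulgA c) cd -mulgA.
  rewrite (mulgA c' c) -cc' -mulgA (mulgA c' d') c'd' cc' -mulgA (mulgA c' c').
  by rewrite c'c' mul1g.
have [e [i [j [k [l [m [q uE]]]]]]] :=
  normal_word_exists xK aE cE dE c'E d'E fE f'E dd' cc' d'f' u.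
set w := normal_word e i j k l m q in uE.
have uw : normal_closure (grig_relators 3) (inv_word u ++ w).
  by apply/eval_pres_gen_eq1; rewrite eval_cat eval_inv -/x uE mulVg.
have w0 : w = [::].
  apply: normal_word_trivial; have [_ fM _ _] := fix_level_normal 3.
  have := ncl_fix_level (leqnn 3) uw; rewrite eval_cat eval_inv => fix_uw.
  by have := fM _ _ fix_u fix_uw; rewrite mulVKg.
by apply/eval_pres_gen_eq1; rewrite -/x uE w0 eval_nil.
Qed.

Theorem level_ncl n u : (3 <= n)%N ->
  fix_level n (eval_word grig_autos u) -> normal_closure (grig_relators n) u.
Proof.
elim: n u => // n IHn u; rewrite leq_eqVlt => /predU1P[[<-]|n3].
  exact: level_ncl3.
by move: u; apply: level_ncl_step => // u; exact: IHn.
Qed.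

(** * Lower bounds for generators and relators *)

Lemma addF2 (x : 'F_2) : (x + x = 0)%R.
Proof. by apply/val_inj; case: x => [[|[|]]]. Qed.

Lemma oppF2 (x : 'F_2) : (- x = x)%R.
Proof.
by apply/eqP; rewrite -GRing.subr_eq0 -GRing.opprD addF2 GRing.oppr0.
Qed.

Lemma gen_subgroup_eval (G : groupType) (S : set G) (I : Type) (x : I -> G) g :
    (forall s, S s -> exists u, eval_word x u = s) ->
  g \in gen_subgroup S -> exists u, eval_word x u = g.
Proof.
move=> Sx /asboolP/(_ (fun h => `[< exists u, eval_word x u = h >])) h.
apply/asboolP; apply: h => [|s /Sx ?]; last exact/asboolP.
split=> [|y z /asboolP[u <-] /asboolP[v <-]]; apply/asboolP.
  by exists [::]; rewrite eval_nil.
by exists (u ++ inv_word v); rewrite eval_cat eval_inv.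
Qed.

Lemma generates_eval (G : groupType) t (x : 'I_t -> G) g :
  generates x -> exists u, eval_word x u = g.
Proof.
move=> /(_ g); apply: gen_subgroup_eval => s [i _ <-].
by exists [:: (i, false)]; rewrite eval_cons eval_nil mulg1.
Qed.

Section ExponentVector.
Variable t : nat.

(** The sign of a letter is ignored because exponents are taken modulo 2. *)
Definition exponents (u : word 'I_t) : 'rV['F_2]_t :=
  \row_i ((count (fun l => l.1 == i) u)%:R)%R.

Lemma exponents_cat u v : exponents (u ++ v) = (exponents u + exponents v)%R.
Proof. by apply/rowP => i; rewrite !mxE count_cat GRing.natrD. Qed.

Lemma exponents_nil : exponents [::] = 0%R.
Proof. by apply/rowP => i; rewrite !mxE. Qed.

Lemma exponents_square u : exponents (u ++ u) = 0%R.
Proof. by apply/rowP => i; rewrite exponents_cat !mxE addF2. Qed.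

Lemma exponents_inv u : exponents (inv_word u) = exponents u.
Proof.
apply/rowP => i; rewrite !mxE /inv_word count_rev count_map.
by congr (_%:R)%R; apply: eq_count.
Qed.

Lemma exponents1 i e : exponents [:: (i, e)] = delta_mx ord0 i.
Proof. by apply/rowP => j; rewrite !mxE /= addn0 eq_sym. Qed.

Lemma exponents_cancel u l v :
  exponents (u ++ [:: l; inv_letter l] ++ v) = exponents (u ++ v).
Proof.
rewrite !exponents_cat -cat1s exponents_cat.
rewrite -[[:: inv_letter l]]/(inv_word [:: l]).
by rewrite exponents_inv -(exponents_cat [:: l]) exponents_square GRing.add0r.
Qed.

Lemma exponents_ncl (R : seq (word 'I_t)) u :
    (forall r, r \in R -> exponents r = 0%R) ->
  normal_closure R u -> exponents u = 0%R.
Proof.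
move=> R0; elim=> {u}
  [r /R0|//|u v _ hu _ hv|u _ hu|u g _ hu|u l v _|u l v _] //.
- exact: exponents_nil.
- by rewrite exponents_cat hu hv GRing.addr0.
- by rewrite exponents_inv.
- rewrite !exponents_cat hu exponents_inv GRing.add0r -exponents_cat.
  exact: exponents_square.
- by rewrite exponents_cancel.
- by rewrite exponents_cancel.
Qed.

End ExponentVector.

Lemma exponents_hom_word s t (w : 'I_s -> word 'I_t) u :
  exponents (hom_word w u) =
  (exponents u *m (\matrix_(i < s) exponents (w i)))%R.
Proof.
elim: u => [|[i e] u IHu]; first by rewrite !exponents_nil mul0mx.
rewrite -cat1s !exponents_cat IHu mulmxDl exponents1 -rowE rowK.
by congr (_ + _)%R; case: e; rewrite //= ?exponents_inv.
Qed.

Section Functional.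
Variables (I : Type) (N : word I -> Prop).

(* A functional on N / [N, F] N^2, where N is the normal subgroup of the free
   group F with membership predicate [N]. *)
Definition functional (lam : word I -> 'F_2) :=
  [/\ forall u v, N u -> N v -> lam (u ++ v) = (lam u + lam v)%R,
      forall u g, N u -> lam (inv_word g ++ u ++ g) = lam u
    & forall u l v, lam (u ++ [:: l; inv_letter l] ++ v) = lam (u ++ v)].

Lemma functional_cancel lam p v q : functional lam ->
  lam (p ++ (v ++ inv_word v) ++ q) = lam (p ++ q).
Proof.
case=> _ _ red; elim: v p q => [|l v IHv] p q //=.
rewrite inv_word_cons -cats1.
have -> : p ++ l :: (v ++ inv_word v ++ [:: inv_letter l]) ++ q =
    (p ++ [:: l]) ++ (v ++ inv_word v) ++ ([:: inv_letter l] ++ q).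
  by rewrite -!catA.
by rewrite IHv -!catA red.
Qed.

End Functional.

(** * Counting relators with dual functionals *)

Section LowerBound.
Variables (G : groupType) (d k : nat) (g : 'I_d -> G) (s : 'I_k -> word 'I_d).
Variable lam : 'I_k -> word 'I_d -> 'F_2.
Local Notation N := (fun u => eval_word g u = 1).
Hypothesis g_gen : generates g.
Hypothesis sN : forall i, eval_word g (s i ++ s i) = 1.
Hypothesis lamN : forall j, functional N (lam j).
Hypothesis lam_s : forall i j, lam j (s i ++ s i) = (i == j)%:R%R.

Let lam_nil j : lam j [::] = 0%R.
Proof.
have [add _ _] := lamN j; have := add [::] [::] (eval_nil g) (eval_nil g).
by rewrite addF2.
Qed.

Let lam_inv j u : eval_word g u = 1 -> lam j (inv_word u) = lam j u.
Proof.
move=> u1; have [add _ _] := lamN j.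
have u1' : eval_word g (inv_word u) = 1 by rewrite eval_inv u1 invg1.
have /eqP := functional_cancel [::] u [::] (lamN j).
rewrite /= cats0 lam_nil add // GRing.addrC GRing.addr_eq0 oppF2.
by move/eqP.
Qed.

(** Write q = pr with r in the kernel: then q^2 = (p r p^-1) p^2 r, and the two contributions of r
    cancel in characteristic 2. *)
Let lam_square j p q : eval_word g p = eval_word g q ->
  eval_word g (q ++ q) = 1 -> lam j (p ++ p) = lam j (q ++ q).
Proof.
move=> pq q1; have [add conj _] := lamN j.
have p1 : eval_word g (p ++ p) = 1 by rewrite eval_cat pq -eval_cat.
pose r := inv_word p ++ q.
have r1 : eval_word g r = 1 by rewrite eval_cat eval_inv pq mulVg.
pose rp := inv_word (inv_word p) ++ r ++ inv_word p.
have rp1 : eval_word g rp = 1.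
  by rewrite eval_cat (eval_cat _ r) r1 mul1g !eval_inv mulVg.
have -> : lam j (q ++ q) = lam j (rp ++ (p ++ p) ++ r).
  have e1 := functional_cancel [::] p (q ++ q) (lamN j).
  have e2 := functional_cancel (p ++ inv_word p ++ q) p q (lamN j).
  have e3 := functional_cancel (p ++ inv_word p ++ q) (inv_word p)
    (p ++ inv_word p ++ q) (lamN j).
  rewrite inv_wordK -!catA /= in e1 e2 e3.
  by rewrite /rp /r inv_wordK -!catA -e1 -e2 -e3.
have pr1 : eval_word g ((p ++ p) ++ r) = 1 by rewrite eval_cat p1 r1 mulg1.
rewrite (add _ _ rp1 pr1) (add _ _ p1 r1) conj // GRing.addrCA addF2.
by rewrite GRing.addr0.
Qed.

(* For words u in the kernel of [x] the vectors [Phi u] span a space of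
   dimension at most [size R].  It contains the k basis vectors of the first
   block and, in the second block, the rows of 1 + YW, where YW factors through
   dimension d. *)
Lemma lower_bound t (x : 'I_t -> G) R :
  presents x R -> (k + t <= size R + d)%N.
Proof.
move=> [x_gen xR].
(* Words translating each generating family into the other: [y i] expresses x_i in the g_j, and
   [w j] expresses g_j in the x_i. *)
have [y yE] := choice (fun i => generates_eval (x i) g_gen).
have [w wE] := choice (fun j => generates_eval (g j) x_gen).
have yN u : eval_word g (hom_word y u) = eval_word x u.
  by rewrite eval_hom_word; exact: eq_eval.
pose Phi u := row_mx (\row_j (lam j (hom_word y u)))%R (exponents u).
pose A := (\matrix_(i < size R) Phi (nth [::] R i))%R.
have rowA u : normal_closure R u -> (Phi u <= A)%MS.
  have Phi_cat v v' : eval_word x v = 1 -> eval_word x v' = 1 ->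
      Phi (v ++ v') = (Phi v + Phi v')%R.
    move=> v1 v'1; rewrite /Phi hom_word_cat exponents_cat add_row_mx.
    congr row_mx; apply/rowP => j; rewrite !mxE.
    by have [-> //] := lamN j; rewrite yN.
  have Phi_cancel v l v' :
      Phi (v ++ [:: l; inv_letter l] ++ v') = Phi (v ++ v').
    rewrite /Phi exponents_cancel; congr row_mx; apply/rowP => j; rewrite !mxE.
    rewrite -[[:: l; _]]/([:: l] ++ inv_word [:: l]) !hom_word_cat hom_word_inv.
    exact: functional_cancel.
  elim=> {u} [r Rr||u v hu Au hv Av|u hu Au|u h hu Au|u l v _|u l v _].
  - have rlt : (index r R < size R)%N by rewrite index_mem.
    by have := row_sub (Ordinal rlt) A; rewrite rowK nth_index.
  - suff -> : Phi [::] = 0%R by exact: sub0mx.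
    rewrite /Phi exponents_nil -row_mx0; congr row_mx.
    by apply/rowP => j; rewrite !mxE lam_nil.
  - by rewrite Phi_cat ?addmx_sub //; exact/xR.
  - suff -> : Phi (inv_word u) = Phi u by [].
    rewrite /Phi exponents_inv; congr row_mx; apply/rowP => j; rewrite !mxE.
    by rewrite hom_word_inv lam_inv // yN; exact/xR.
  - suff -> : Phi (inv_word h ++ u ++ h) = Phi u by [].
    rewrite /Phi !exponents_cat exponents_inv GRing.addrCA -exponents_cat.
    rewrite exponents_square GRing.addr0; congr row_mx; apply/rowP => j.
    rewrite !mxE !hom_word_cat hom_word_inv.
    by have [_ -> //] := lamN j; rewrite yN; exact/xR.
  - by rewrite Phi_cancel.
  - by rewrite Phi_cancel.
have rows_s : (row_mx (1%:M : 'M['F_2]_k) (0 : 'M_(k, t))%R <= A)%MS.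
  apply/row_subP => j.
  have [u uE] := generates_eval (eval_word g (s j)) x_gen.
  (* A square has exponent vector 0, and by [lam_square] its functional values are those of the
     square of s_j. *)
  suff <- : Phi (u ++ u) = row j (row_mx 1%:M (0 : 'M_(k, t))%R).
    apply: rowA; apply/xR.
    by rewrite eval_cat uE -eval_cat.
  rewrite row_row_mx /Phi exponents_square row0 row1; congr row_mx.
  apply/rowP => i; rewrite !mxE hom_word_cat (lam_square _ (q := s j)) //.
    by rewrite lam_s eq_sym.
  by rewrite yN.
pose Y := (\matrix_i exponents (y i))%R.
pose W := (\matrix_j exponents (w j))%R.
have rows_x : exists X, (row_mx X (1%:M + Y *m W)%R <= A)%MS.
  (* The word x_i^-1 y_i(w) is trivial in G, and its exponent vector modulo 2 is row i of 1 + YW. *)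
  pose v i := (i, true) :: hom_word w (y i).
  exists (\matrix_i \row_j lam j (hom_word y (v i)))%R.
  apply/row_subP => i; rewrite row_row_mx rowK.
  suff -> : row i (1%:M + Y *m W)%R = exponents (v i).
    apply: rowA; apply/xR; rewrite eval_cons eval_hom_word.
    by rewrite (eq_eval (y := g)) // yE mulVg.
  rewrite /v -cat1s exponents_cat exponents1 exponents_hom_word.
  by rewrite GRing.linearD /= row1 row_mul rowK.
have [X rows_X] := rows_x.
have rows_Z : (row_mx (0 : 'M_(t, k))%R (1%:M + Y *m W)%R <= A)%MS.
  have -> : row_mx (0 : 'M_(t, k))%R (1%:M + Y *m W)%R =
      (row_mx X (1%:M + Y *m W) - X *m row_mx 1%:M 0)%R.
    rewrite mul_mx_row mulmx1 mulmx0 opp_row_mx add_row_mx.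
    by rewrite GRing.subrr GRing.oppr0 GRing.addr0.
  by rewrite addmx_sub // eqmx_opp mulmx_sub.
have : (block_mx 1%:M 0 0 (1%:M + Y *m W) <= A)%MS%R.
  by rewrite /block_mx col_mx_sub rows_s.
move/mxrankS; rewrite rank_diag_block_mx mxrank1 => rk.
have rkA : (\rank A <= size R)%N by exact: rank_leq_row.
(* The identity of size t is (1 + YW) - YW, and YW has rank at most d. *)
have : (t <= \rank (1%:M + Y *m W)%R + d)%N.
  rewrite -{1}(mxrank1 'F_2 t).
  have {1}-> : (1%:M = (1%:M + Y *m W) - Y *m W :> 'M['F_2]_t)%R.
    by rewrite GRing.addrK.
  apply: leq_trans (mxrank_add _ _) _; rewrite leq_add2l mxrank_opp.
  by apply: leq_trans (mxrankM_maxl _ _) _; exact: rank_leq_col.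
move=> tle; apply: leq_trans (_ : k + (\rank (1%:M + Y *m W)%R + d) <= _)%N.
  by rewrite leq_add2l.
by rewrite addnA leq_add2r (leq_trans rk).
Qed.

End LowerBound.

(** Each word g_j^-1 w_j(y) is trivial in G, so its exponents vanish and WY = 1: the identity of
    size d factors through dimension t. *)
Lemma generators_lower_bound (G : groupType) d (g : 'I_d -> G) :
    generates g -> (forall u, eval_word g u = 1 -> exponents u = 0%R) ->
  forall t (x : 'I_t -> G), generates x -> (d <= t)%N.
Proof.
move=> g_gen g_exp t x x_gen.
have [y yE] := choice (fun i => generates_eval (x i) g_gen).
have [w wE] := choice (fun j => generates_eval (g j) x_gen).
pose Y := (\matrix_i exponents (y i))%R.
pose W := (\matrix_j exponents (w j))%R.
suff WY : (W *m Y = 1%:M)%R.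
  rewrite -(mxrank1 'F_2 d) -WY.
  by apply: leq_trans (mxrankM_maxl _ _) _; exact: rank_leq_col.
apply/row_matrixP => j; rewrite row_mul rowK row1 -exponents_hom_word.
have := g_exp ((j, true) :: hom_word y (w j)); rewrite eval_cons eval_hom_word.
rewrite (eq_eval (y := x)) // wE mulVg => /(_ erefl).
rewrite -cat1s exponents_cat exponents1 => /eqP.
rewrite GRing.addr_eq0 => /eqP ->; apply/rowP => i; by rewrite !mxE oppF2.
Qed.

(** * Independence of the relators *)

Section InvFunctional.
Variables (P : groupType) (M : P -> Prop).

Definition inv_functional (mu : P -> 'F_2) :=
  (forall g h, M g -> M h -> mu (g * h) = (mu g + mu h)%R) /\
  (forall g h, M g -> mu (g ^ h) = mu g).

Lemma inv_functionalD mu nu : inv_functional mu -> inv_functional nu ->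
  inv_functional (fun g => mu g + nu g)%R.
Proof.
move=> [muM muJ] [nuM nuJ]; split=> g h Mg => [Mh|]; last by rewrite muJ ?nuJ.
by rewrite muM ?nuM // GRing.addrACA.
Qed.

Lemma inv_functionalZ c mu : inv_functional mu ->
  inv_functional (fun g => c * mu g)%R.
Proof.
move=> [muM muJ]; split=> g h Mg => [Mh|]; last by rewrite muJ.
by rewrite muM // GRing.mulrDr.
Qed.

Hypothesis M_normal : normal_pred M.
Variable mu : P -> 'F_2.
Hypothesis muP : inv_functional mu.

Lemma inv_functional1 : mu 1 = 0%R.
Proof.
have [M1 _ _ _] := M_normal; have [add _] := muP.
by have := add 1 1 M1 M1; rewrite addF2 mul1g.
Qed.

Lemma inv_functionalX g k : M g -> mu g = 0%R ->
  M (g ^+ k) /\ mu (g ^+ k) = 0%R.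
Proof.
have [M1 MM _ _] := M_normal; have [add _] := muP => Mg g0.
elim: k => [|k [Mk k0]]; first by split=> //; exact: inv_functional1.
by rewrite expgS; split; [exact: MM | rewrite add // g0 k0 GRing.addr0].
Qed.

Lemma inv_functionalV g : M g -> mu g^-1 = mu g.
Proof.
have [_ _ MV _] := M_normal; have [add _] := muP => Mg.
have /eqP := add g g^-1 Mg (MV _ Mg).
rewrite mulgV inv_functional1 eq_sym GRing.addrC GRing.addr_eq0 oppF2.
by move/eqP.
Qed.

Lemma functional_eval (I : Type) (N : word I -> Prop) (x : I -> P) :
    (forall u, N u -> M (eval_word x u)) ->
  functional N (fun u => mu (eval_word x u)).
Proof.
have [add conj] := muP => NM; split.
- by move=> u v /NM Mu /NM Mv; rewrite eval_cat add.
- by move=> u g /NM Mu; rewrite !eval_cat eval_inv conj.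
- move=> u [i e] v; rewrite !eval_cat !eval_cons eval_nil mulg1 /=.
  by case: e; rewrite /= ?mulgV ?mulVg mul1g.
Qed.

End InvFunctional.

Lemma functionalD (I : Type) (N : word I -> Prop) lam mu :
  functional N lam -> functional N mu -> functional N (fun u => lam u + mu u)%R.
Proof.
move=> [a1 c1 r1] [a2 c2 r2]; split=> [u v Nu Nv|u g Nu|u l v].
- by rewrite a1 // a2 // GRing.addrACA.
- by rewrite c1 // c2.
- by rewrite r1 r2.
Qed.

Lemma functionalZ (I : Type) (N : word I -> Prop) c lam :
  functional N lam -> functional N (fun u => c * lam u)%R.
Proof.
move=> [a1 c1 r1]; split=> [u v Nu Nv|u g Nu|u l v].
- by rewrite a1 // GRing.mulrDr.
- by rewrite c1.
- by rewrite r1.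
Qed.

(** * Automorphisms changing only the last letter *)

Section LevelCenter.

Fixpoint flip_last (e : bool) (w : seq bool) : seq bool :=
  match w with
  | [::] => [::]
  | [:: x] => [:: x (+) e]
  | x :: w' => x :: flip_last e w'
  end.

Lemma flip_last_rcons e w x : flip_last e (rcons w x) = rcons w (x (+) e).
Proof. by elim: w => //= y w ->; case: w. Qed.

Lemma flip_last0 w : flip_last false w = w.
Proof. by case/lastP: w => // w x; rewrite flip_last_rcons addbF. Qed.

Lemma flip_lastD e f w : flip_last e (flip_last f w) = flip_last (e (+) f) w.
Proof.
by case/lastP: w => // w x; rewrite !flip_last_rcons -addbA (addbC f).
Qed.

Lemma size_flip_last e w : size (flip_last e w) = size w.
Proof. by case/lastP: w => // w x; rewrite flip_last_rcons !size_rcons. Qed.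

Lemma taut_flip_last (h : treeAut) e w : h (flip_last e w) = flip_last e (h w).
Proof.
case: e; last by rewrite !flip_last0.
case/lastP: w => [|w x]; first by rewrite !taut_root.
rewrite flip_last_rcons.
have [y hy] := taut_child h w x; have [z hz] := taut_child h w (x (+) true).
rewrite hy hz flip_last_rcons; congr rcons.
have : y != z.
  apply/eqP => yz; have := can_inj (tautK h).
  have /(congr1 (taut_inv h)) : h (rcons w x) = h (rcons w (x (+) true)).
    by rewrite hy hz yz.
  by rewrite !tautK => /rcons_inj[]; case: x {hy hz}.
by case: y z {hy hz} => [] [].
Qed.

Variable k : nat.

(** The parameter [k] stands for the level k + 1, whose words always have a last letter. *)
Definition flips (e : bool) (g : treeAut) :=
  forall w, size w = k.+1 -> g w = flip_last e w.

(* The center of the automorphism group of the first k+1 levels consists of the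
   identity and of the map changing the last letter of every word. *)
Definition level_central g := exists e, flips e g.

Lemma level_central_normal : normal_pred level_central.
Proof.
split.
- by exists false => w sw; rewrite flip_last0.
- move=> g h [e ge] [f hf]; exists (e (+) f) => w sw.
  by rewrite -flip_lastD -hf // -ge // hf ?size_flip_last.
- move=> g [e ge]; exists e => w sw; have := tautK g (flip_last e w).
  by rewrite ge ?size_flip_last // flip_lastD addbb flip_last0.
- move=> g h [e ge]; exists e => w sw; have := tautK h (flip_last e w).
  by rewrite taut_flip_last -ge ?size_taut.
Qed.

Definition last_flip (g : treeAut) : 'F_2 :=
  ((last false (g (nseq k.+1 false)) : nat)%:R)%R.

Lemma last_flipE e g : flips e g -> last_flip g = (e%:R)%R.
Proof.
rewrite /last_flip => ->; last by rewrite size_nseq.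
have -> : nseq k.+1 false = rcons (nseq k false) false.
  by elim: k => //= j ->.
by rewrite flip_last_rcons last_rcons.
Qed.

Lemma last_flip_functional : inv_functional level_central last_flip.
Proof.
split=> [g h [e ge] [f hf]|g h [e ge]].
  have gh : flips (e (+) f) (g * h).
    move=> w sw; rewrite -flip_lastD -hf // -ge // hf ?size_flip_last //.
  rewrite (last_flipE gh) (last_flipE ge) (last_flipE hf).
  by apply: val_inj; case: e f {ge hf gh} => [] [].
have gh : flips e (g ^ h).
  move=> w sw; have := tautK h (flip_last e w).
  by rewrite taut_flip_last -ge ?size_taut.
by rewrite (last_flipE gh) (last_flipE ge).
Qed.

Definition flips_check (x : 'I_3 -> treeAut) e (u : word 'I_3) :=
  all (fun l => ~~ l.2) u &&
  all (fun w => foldr (fun l => x l.1) w u == flip_last e w) (bool_words k.+1).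

Lemma flips_checkP x e u : flips_check x e u -> flips e (eval_word x u).
Proof.
move=> /andP[pos chk] w sw; rewrite eval_positive //; apply/eqP.
by have /allP := chk; apply; rewrite -sw mem_bool_words.
Qed.

Definition central_check (x : 'I_3 -> treeAut) (u : word 'I_3) :=
  flips_check x false u || flips_check x true u.

Lemma central_checkP x u : central_check x u -> level_central (eval_word x u).
Proof. by case/orP=> /flips_checkP; [exists false | exists true]. Qed.

End LevelCenter.

(** An automorphism fixing a vertex permutes its two children, and the square of this permutation is
    the identity. *)
Lemma fix_level_square k g : fix_level k g -> fix_level k.+1 (g * g).
Proof.
move=> gk w; case/lastP: w => // w x; rewrite size_rcons => -[sw].
have [y gy] := taut_child g w x; have [z gz] := taut_child g w y.
rewrite (gk w sw) in gy gz; transitivity (g (g (rcons w x))) => //.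
rewrite gy gz; case: (eqVneq y x) => [yx|yx].
  by rewrite -gz yx gy yx.
congr rcons; have : z != y.
  apply/eqP => zy; have := congr1 (taut_inv g) gz.
  by rewrite tautK zy -gy tautK gy => /rcons_inj[] yx'; rewrite yx' eqxx in yx.
by case: x y z yx {gy gz} => [] [] [].
Qed.

Lemma fix_level2_exp4 g : fix_level 2 (g ^+ 4).
Proof.
rewrite (expgnA _ 2 2) !expg2; do 2!apply: fix_level_square.
by case=> // _; exact: taut_root.
Qed.

(** * Functionals on the group presented by the Klein relators *)

Definition gam : 'I_3 -> pres_group klein_relators := pres_gen klein_relators.

Local Notation Gam := (pres_group klein_relators).

Lemma klein_gam : klein_gens gam.
Proof. by apply/klein_gensP => r; exact: eval_pres_gen_relator. Qed.

Lemma gam_word (g : Gam) : exists u, g = eval_word gam u.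
Proof. by exists (pres_word g); rewrite eval_pres_gen pres_wordK. Qed.

Lemma lift_gam (G : groupType) (x : 'I_3 -> G) u :
  klein_gens x -> pres_lift x (eval_word gam u) = eval_word x u.
Proof. by move=> /klein_gensP xR; exact: pres_lift_eval. Qed.

Lemma lift_gamM (G : groupType) (x : 'I_3 -> G) :
  klein_gens x -> {morph (pres_lift x : Gam -> G) : g h / g * h}.
Proof. by move=> /klein_gensP xR; exact: pres_liftM. Qed.

Definition gam_fix n (g : Gam) := fix_level n (pres_lift grig_autos g).

Lemma gam_fixE n u :
  gam_fix n (eval_word gam u) <-> fix_level n (eval_word grig_autos u).
Proof. by rewrite /gam_fix (lift_gam _ klein_grig). Qed.

Lemma gam_fix_normal n : normal_pred (gam_fix n).
Proof.
have [h1 hM hV hJ] := fix_level_normal n.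
have M := lift_gamM klein_grig.
have e1 : pres_lift grig_autos (1 : Gam) = 1.
  by rewrite -(eval_nil gam) (lift_gam _ klein_grig) eval_nil.
have eV (g : Gam) : pres_lift grig_autos g^-1 = (pres_lift grig_autos g)^-1.
  by apply: (mulgI (pres_lift grig_autos g)); rewrite -M !mulgV e1.
rewrite /gam_fix; split=> [|g h|g|g h]; rewrite ?e1 ?M ?eV //.
- exact: hM.
- exact: hV.
- exact: hJ.
Qed.

(** The wreath recursion is a homomorphism on [Gam] because [psi_gens] satisfies the Klein relators.
    Functionals built on [Gam] vanish on these relators. *)
Definition psi : Gam -> wreath Gam := pres_lift (psi_gens gam).

Lemma psiM : {morph psi : g h / g * h}.
Proof. apply: lift_gamM; exact: klein_psi klein_gam. Qed.

Lemma psiV g : psi g^-1 = (psi g)^-1.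
Proof.
have [u ->] := gam_word g.
by rewrite -eval_inv /psi !(lift_gam _ (klein_psi klein_gam)) eval_inv.
Qed.

Lemma gam_fix_psi n g : gam_fix n.+1 g <->
  [/\ (psi g).2 = false, gam_fix n (psi g).1.1 & gam_fix n (psi g).1.2].
Proof.
rewrite -fix_level_node /gam_fix; have [u ->] := gam_word g.
rewrite (lift_gam _ klein_grig) grig_node.
suff -> : eval_word (psi_gens grig_autos) u =
    wr_map (pres_lift grig_autos) (psi (eval_word gam u)) by [].
rewrite /psi (lift_gam _ (klein_psi klein_gam)).
have M := lift_gamM klein_grig.
rewrite (eval_morph _ _ (wr_mapM M)); apply: eq_eval.
have e i : pres_lift grig_autos (gam i) = grig_autos i.
  have := lift_gam [:: (i, false)] klein_grig.
  by rewrite !eval_cons !eval_nil !mulg1.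
have e1 : pres_lift grig_autos (1 : Gam) = 1.
  by rewrite -(eval_nil gam) (lift_gam _ klein_grig) eval_nil.
by apply: ord3P; rewrite /psi_gens /wr_map /triple /= ?M ?e ?e1.
Qed.

Lemma psi_sigma u : psi (eval_word gam (sigma u)) =
  ((eval_word (theta_gens gam) u, eval_word gam u), false).
Proof.
by rewrite /psi (lift_gam _ (klein_psi klein_gam)) (eval_psi_sigma klein_gam).
Qed.

(** Functionals transferred through [psi] therefore vanish on u_0 and v_0, whose values must come
    from another source. *)
Lemma psi_relators : psi (eval_word gam (rel_u 0)) = 1 /\
  psi (eval_word gam (rel_v 0)) = 1.
Proof.
have [aa bb cc dd] := klein_gam.
have aK g : gam ia * (gam ia * g) = g by rewrite mulgA aa mul1g.
have bK g : gam ib * (gam ib * g) = g by rewrite mulgA bb mul1g.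
have cbc : gam ic * (gam ib * gam ic) = gam ib.
  by rewrite mulgA (klein_commute klein_gam) -mulgA cc mulg1.
have dK g : gam ib * gam ic * (gam ib * gam ic * g) = g.
  by rewrite mulgA dd mul1g.
rewrite /psi !(lift_gam _ (klein_psi klein_gam)) rel_u0_eval.
have pd : psi_gens gam ib * psi_gens gam ic = ((1, gam ib), false).
  by rewrite /psi_gens /triple /= wr_mulE /wr_mul /= aa cbc.
have mulF (f0 f1 g0 g1 : Gam) s :
    (((f0, f1), s) : wreath Gam) * ((g0, g1), false) =
    ((f0 * g0, f1 * g1), s) by rewrite wr_mulE /wr_mul /= addbF.
have mulT (f0 f1 g0 g1 : Gam) s :
    (((f0, f1), s) : wreath Gam) * ((g0, g1), true) =
    ((f1 * g0, f0 * g1), ~~ s) by rewrite wr_mulE /wr_mul /= addbT.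
have pa : psi_gens gam ia = ((1, 1), true) by [].
have pc : psi_gens gam ic = ((gam ia, gam ib * gam ic), false) by [].
move: pd pc aa bb dd aK bK dK {cc cbc}; move: (gam ib * gam ic) => d.
move: (gam ia) (gam ib) => a b pd pc aa bb dd aK bK dK.
split.
  rewrite pd pa (mulF 1 1 1 b) (expgnA _ 2 2) !expg2.
  rewrite (mulT (1 * 1) (1 * b) (1 * 1) (1 * b)) (mulF _ _ (1 * b * (1 * 1)) _).
  by rewrite !mul1g !mulg1 bb.
rewrite eval_pow !eval_cons eval_nil mulg1 /= (mulgA (psi_gens gam ib)) pd.
rewrite pc pa (mulF 1 1 a d) !mul1g (mulT a d a d) (mulT 1 1 (d * a) (a * d)).
rewrite !mul1g (mulF 1 b (d * a) (a * d)) mul1g (mulF 1 1 (d * a)) !mul1g.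
rewrite (expgnA _ 2 2) !expg2 (mulT (d * a) (b * (a * d)) (d * a)).
rewrite (mulF (b * (a * d) * (d * a)) (d * a * (b * (a * d)))).
by rewrite -!mulgA !(aK, bK, dK, dd, bb, aa).
Qed.

(** Conjugation conjugates the two sections and possibly exchanges them, which their sum does not
    see. *)
Lemma gam_transfer n mu : inv_functional (gam_fix n) mu ->
  inv_functional (gam_fix n.+1) (fun g => mu (psi g).1.1 + mu (psi g).1.2)%R.
Proof.
move=> [muM muJ]; split=> g h.
  move=> /gam_fix_psi[g2 g0 g1] /gam_fix_psi[h2 h0 h1].
  by rewrite psiM wr_mulE /wr_mul h2 /= !muM // GRing.addrACA.
move=> /gam_fix_psi[g2 g0 g1]; rewrite /conjg !psiM psiV wr_invE !wr_mulE.
case: (psi g) g2 g0 g1 => [[g0 g1] s] /= -> m0 m1.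
case: (psi h) => [[h0 h1] []] /=.
  by rewrite /wr_inv /wr_mul /= (muJ _ h0) // (muJ _ h1) // GRing.addrC.
by rewrite /wr_inv /wr_mul /= (muJ _ h0) // (muJ _ h1).
Qed.

Lemma rel_u0_fix n : gam_fix n (eval_word gam (rel_u 0)).
Proof. by apply/gam_fixE; rewrite grig_rel_u0. Qed.

(** The section at 0 is a fourth power in the group generated by d and a, hence a power of u_0 or of
    its inverse, where [mu] vanishes; the section at 1 is u^4. *)
Lemma transfer_sigma n mu u : inv_functional (gam_fix n) mu ->
    mu (eval_word gam (rel_u 0)) = 0%R ->
  (mu (psi (eval_word gam (sigma (pow_word u 4)))).1.1
    + mu (psi (eval_word gam (sigma (pow_word u 4)))).1.2)%R =
  mu (eval_word gam (pow_word u 4)).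
Proof.
move=> muP u0; rewrite psi_sigma /=.
rewrite [X in (X + _)%R](_ : _ = 0%R) ?GRing.add0r //.
have [aa _ _ dd] := klein_gam; have nN := gam_fix_normal n.
have ad4 : mu ((gam ia * (gam ib * gam ic)) ^+ 4) = 0%R by rewrite -rel_u0_eval.
have fix4 : gam_fix n ((gam ia * (gam ib * gam ic)) ^+ 4).
  by rewrite -rel_u0_eval; exact: rel_u0_fix.
rewrite eval_pow; have [|k [] ->] := dihedral_form_expg4 dd aa
    (eval_dihedral (x := theta_gens gam) dd aa u _).
- by apply: ord3P; rewrite /theta_gens /= /triple /=;
    [constructor 2 | constructor 1 | constructor 3].
- have -> : gam ib * gam ic * gam ia = (gam ia * (gam ib * gam ic))^-1.
    by rewrite invgM (mulg1_eq aa) (mulg1_eq dd).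
  have [_ _ nV _] := nN; rewrite expVgn.
  have [] // := inv_functionalX nN muP k (nV _ fix4).
  by rewrite (inv_functionalV nN muP).
- by have [] := inv_functionalX nN muP k fix4 ad4.
Qed.

Lemma fix_level_le m n g : (m <= n)%N -> fix_level n g -> fix_level m g.
Proof.
elim: n => [|n IHn]; first by rewrite leqn0 => /eqP->.
rewrite leq_eqVlt => /predU1P[->//|mn] fix_g; apply: IHn => // w sw.
have [y gy] := taut_child g w false.
have := fix_g (rcons w false); rewrite size_rcons sw gy.
by move=> /(_ erefl)/rcons_inj[].
Qed.

(** By the presentation for level m, an element fixing level n >= m is a consequence of the relators
    of level m; as these have central values, so has the element. *)
Lemma rep_functional (x : 'I_3 -> treeAut) k m n :
    klein_gens x -> (3 <= m <= n)%N ->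
    all (central_check k x) (grig_relators m) ->
  inv_functional (gam_fix n) (fun g => last_flip k (pres_lift x g)).
Proof.
move=> xK /andP[m3 mn] /allP chk.
have central g : gam_fix n g -> level_central k (pres_lift x g).
  have [u ->] := gam_word g; rewrite gam_fixE (lift_gam _ xK) => fix_u.
  have /level_ncl := fix_level_le mn fix_u.
  move=> /(_ m3); apply: ncl_eval; first exact: level_central_normal.
  by move=> r /chk; exact: central_checkP.
have M := lift_gamM xK; have [muM muJ] := last_flip_functional k.
split=> [g h /central Mg /central Mh|g h /central Mg]; first by rewrite M muM.
have -> : pres_lift x (g ^ h) = pres_lift x g ^ pres_lift x h;
  last by rewrite muJ.
apply: (mulgI (pres_lift x h)); rewrite -M /conjg mulVKg M.
by rewrite mulgA mulgV mul1g.
Qed.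

(* The values on (u_0, w_3, t_3) of the functionals given by [rep1], [rep2],
   [rep3] are the rows of the identity matrix; those on (u_0, v_0, u_1) given by
   [rep1], [rep5], [rep4] are (1, 1, 0), (0, 1, 0), (0, 0, 1).  The groups of
   [rep1], [rep2], [rep4] are dihedral, generated by [A] and by a truncation of
   the automorphism t with t(0w) = 0 A(w) and t(1w) = 1 t(w).  Modulo the
   center, the conjugates of d in [rep5] are labelled by the vertices of an
   octagon, and two of them commute unless their distance is 3; in [rep3] they
   are labelled by the vertices of a square, and opposite ones do not commute.
   This detects v_0 and t_3, which are squares of products of two conjugates. *)
Local Notation A := aut_a.
Local Notation nd f g := (node (((f, g), false) : wreath treeAut)).

Definition rep1 : 'I_3 -> treeAut := triple A (nd A (nd A 1)) 1.
Definition rep2 : 'I_3 -> treeAut := triple A (nd A (nd A 1)) (nd A (nd A 1)).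
Definition rep3 : 'I_3 -> treeAut :=
  triple (nd (nd 1 (nd 1 A)) (nd 1 A)) A (nd A A).
Definition rep4 : 'I_3 -> treeAut :=
  triple A (nd A (nd A (nd A 1))) (nd A (nd A (nd A 1))).
Definition rep5c : treeAut := nd (nd 1 A) (nd (nd 1 A) (nd 1 A)).
Definition rep5d : treeAut :=
  nd (nd (nd (nd 1 A) (nd 1 A)) (nd (nd 1 A) (nd 1 A))) A.
Definition rep5 : 'I_3 -> treeAut := triple A (rep5c * rep5d) rep5c.

Lemma rep1_central : all (central_check 2 rep1) (grig_relators 3).
Proof. by vm_compute. Qed.
Lemma rep2_central : all (central_check 2 rep2) (grig_relators 3).
Proof. by vm_compute. Qed.
Lemma rep3_central : all (central_check 3 rep3) (grig_relators 3).
Proof. by vm_compute. Qed.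
Lemma rep4_central : all (central_check 3 rep4) (grig_relators 4).
Proof. by vm_compute. Qed.
Lemma rep5_central : all (central_check 4 rep5) (grig_relators 4).
Proof. by vm_compute. Qed.

Lemma rep_klein : [/\ klein_gens rep1, klein_gens rep2, klein_gens rep3,
  klein_gens rep4 & klein_gens rep5].
Proof.
by split; split; apply: treeAutP; do 6![case=> [|[]] //].
Qed.

Lemma rep_value (x : 'I_3 -> treeAut) k e r : klein_gens x ->
  flips_check k x e r -> last_flip k (pres_lift x (eval_word gam r)) = e%:R%R.
Proof.
by move=> xK /flips_checkP chk; rewrite (lift_gam _ xK); exact: last_flipE.
Qed.

Lemma functional_values n (eu ev : nat -> 'F_2) (ew et : 'F_2) : (3 <= n)%N ->
  exists mu, [/\ inv_functional (gam_fix n) mu,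
    forall i, (i < n - 2)%N -> mu (eval_word gam (rel_u i)) = eu i,
    forall i, (i < n - 3)%N -> mu (eval_word gam (rel_v i)) = ev i,
    mu (eval_word gam (rel_w n)) = ew & mu (eval_word gam (rel_t n)) = et].
Proof.
have [k1 k2 k3 k4 k5] := rep_klein.
elim: n eu ev ew et => // n IHn eu ev ew et.
rewrite leq_eqVlt => /predU1P[[<-]|n3].
  exists (fun g => eu 0%N * last_flip 2 (pres_lift rep1 g)
    + ew * last_flip 2 (pres_lift rep2 g)
    + et * last_flip 3 (pres_lift rep3 g))%R; split.
  - by do 2?[apply: inv_functionalD]; apply: inv_functionalZ;
      [apply: (rep_functional k1 _ rep1_central)
      | apply: (rep_functional k2 _ rep2_central)
      | apply: (rep_functional k3 _ rep3_central)].
  - case=> // _; rewrite (rep_value (e := true) k1) ?(rep_value (e := false) k2)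
      ?(rep_value (e := false) k3) //.
    by rewrite !GRing.mulr0 GRing.mulr1 !GRing.addr0.
  - by [].
  - rewrite (rep_value (e := false) k1) ?(rep_value (e := true) k2)
      ?(rep_value (e := false) k3) //.
    by rewrite !GRing.mulr0 GRing.mulr1 GRing.addr0 GRing.add0r.
  - rewrite (rep_value (e := false) k1) ?(rep_value (e := false) k2)
      ?(rep_value (e := true) k3) //.
    by rewrite !GRing.mulr0 GRing.mulr1 !GRing.add0r.
(* The functional of [rep1] takes the value 1 on both u_0 and v_0; the coefficient of [rep5]
   corrects the value on v_0. *)
pose al (g : Gam) := (eu 0%N * last_flip 2 (pres_lift rep1 g)
    + (eu 0%N + ev 0%N) * last_flip 4 (pres_lift rep5 g)
    + eu 1%N * last_flip 3 (pres_lift rep4 g))%R.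
have n2 := ltnW n3.
have alP : inv_functional (gam_fix n.+1) al.
  have m3 : (3 <= 3 <= n.+1)%N := ltnW n3.
  have m4 : (3 <= 4 <= n.+1)%N := n3.
  by do 2?[apply: inv_functionalD]; apply: inv_functionalZ;
      [exact: (rep_functional k1 m3 rep1_central)
      | exact: (rep_functional k5 m4 rep5_central)
      | exact: (rep_functional k4 m4 rep4_central)].
have al_u0 : al (eval_word gam (rel_u 0)) = eu 0%N.
  rewrite /al (rep_value (e := true) k1) ?(rep_value (e := false) k5)
      ?(rep_value (e := false) k4) //.
  by rewrite !GRing.mulr0 GRing.mulr1 !GRing.addr0.
have al_v0 : al (eval_word gam (rel_v 0)) = ev 0%N.
  rewrite /al (rep_value (e := true) k1) ?(rep_value (e := true) k5)
      ?(rep_value (e := false) k4) //.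
  rewrite !GRing.mulr0 !GRing.mulr1 !GRing.addr0 GRing.addrA addF2.
  by rewrite GRing.add0r.
have al_u1 : al (eval_word gam (rel_u 1)) = eu 1%N.
  rewrite /al (rep_value (e := false) k1) ?(rep_value (e := false) k5)
      ?(rep_value (e := true) k4) //.
  by rewrite !GRing.mulr0 !GRing.mulr1 !GRing.add0r.
pose V r := (al (eval_word gam (sigma r))).
(* The values of [al] on the words sigma(r) are subtracted in advance. At u_0 the value is 0, as
   [transfer_sigma] requires, and u_1 = sigma(u_0) gets its value from [al]. *)
have [mu [muP mu_u mu_v mu_w mu_t]] := IHn
  (fun i => if i is 0%N then 0 else eu i.+1 - V (rel_u i))%R
  (fun i => ev i.+1 - V (rel_v i))%R
  (ew - V (rel_w n))%R (et - V (rel_t n))%R n3.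
have mu_u0 : mu (eval_word gam (rel_u 0)) = 0%R by rewrite mu_u // subn_gt0.
have tr r : r \in higher_relators n ->
    (mu (psi (eval_word gam (sigma r))).1.1
    + mu (psi (eval_word gam (sigma r))).1.2)%R = mu (eval_word gam r).
  by move=> /higher_relators_pow4[u ->]; exact: transfer_sigma muP mu_u0.
have [psi_u0 psi_v0] := psi_relators.
have mu1 : mu 1%g = 0%R := inv_functional1 (gam_fix_normal n) muP.
have psi0 g : psi g = 1%g -> (mu (psi g).1.1 + mu (psi g).1.2 = 0)%R.
  by move=> ->; rewrite addF2.
exists (fun g => (mu (psi g).1.1 + mu (psi g).1.2) + al g)%R; split.
- by apply: inv_functionalD alP; exact: gam_transfer.
- case=> [|i]; rewrite subSn // ltnS => ilt.
    by rewrite psi0 // al_u0 GRing.add0r.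
  rewrite (tr (rel_u i)) ?mem_rel_u // mu_u //; case: i ilt => [|i] ilt.
    by rewrite GRing.add0r.
  by rewrite GRing.subrK.
- case=> [|i]; rewrite subSn // ltnS => ilt.
    by rewrite psi0 // al_v0 GRing.add0r.
  by rewrite (tr (rel_v i)) ?mem_rel_v // mu_v // GRing.subrK.
- by rewrite rel_wS // tr ?mem_rel_w // mu_w GRing.subrK.
- by rewrite rel_tS // tr ?mem_rel_t // mu_t GRing.subrK.
Qed.

(** * Functionals detecting the Klein relators *)

Definition cycle4 : treeAut := node (((1, A), true) : wreath treeAut).
Definition rep_a : 'I_3 -> treeAut := triple cycle4 1 1.
Definition rep_b : 'I_3 -> treeAut := triple 1 cycle4 1.
Definition rep_c : 'I_3 -> treeAut := triple 1 1 cycle4.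
(** The images of b and c are involutions generating a dihedral group of order 8, so among the Klein
    relators only (bc)^2 is detected. *)
Definition rep_bc : 'I_3 -> treeAut := triple 1 A (nd A 1).

(** The higher relators are fourth powers, and fourth powers fix level 2; only the Klein relators
    have to be checked. *)
Lemma rep_level2 (x : 'I_3 -> treeAut) n : (3 <= n)%N ->
    all (central_check 1 x) klein_relators ->
  functional (fun u => fix_level n (eval_word grig_autos u))
    (fun u => last_flip 1 (eval_word x u)).
Proof.
move=> n3 /allP chk; apply: functional_eval; first exact: last_flip_functional.
move=> u /(level_ncl n3); apply: ncl_eval; first exact: level_central_normal.
move=> r; rewrite grig_relatorsE mem_cat.
case/orP=> [/chk|/higher_relators_pow4[v ->]].
  exact: central_checkP.
by exists false => w sw; rewrite eval_pow flip_last0 fix_level2_exp4.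
Qed.

Lemma rep_level2_pow4 (x : 'I_3 -> treeAut) n r : r \in higher_relators n ->
  last_flip 1 (eval_word x r) = 0%R.
Proof.
case/higher_relators_pow4=> v ->; apply: (@last_flipE _ false) => w sw.
by rewrite eval_pow flip_last0 fix_level2_exp4.
Qed.

Lemma size_grig_relators n :
  (3 <= n)%N -> size (grig_relators n) = (2 * n + 1)%N.
Proof.
move=> n3; rewrite /grig_relators !size_cat !size_map !size_iota /=.
by lia.
Qed.

Lemma relator_functional n (e : nat -> 'F_2) : (3 <= n)%N ->
  exists2 lam, functional (fun u => fix_level n (eval_word grig_autos u)) lam &
    forall i, (i < size (grig_relators n))%N ->
      lam (nth [::] (grig_relators n) i) = e i.
Proof.
move=> n3.
(* The offsets follow the list of relators: 4 Klein relators, n - 2 words u_i, n - 3 words v_i, then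
   w_n and t_n. *)
have [mu [muP mu_u mu_v mu_w mu_t]] := functional_values
  (fun i => e (4 + i)%N) (fun i => e (4 + (n - 2 + i))%N)
  (e (4 + (n - 2 + (n - 3 + 0)))%N) (e (4 + (n - 2 + (n - 3 + 1)))%N) n3.
(* On (bc)^2 the functionals of [rep_b] and [rep_c] contribute e_1 + e_2, which the coefficient of
   [rep_bc] cancels modulo 2. *)
exists (fun u => e 0%N * last_flip 1 (eval_word rep_a u)
  + e 1%N * last_flip 1 (eval_word rep_b u)
  + e 2%N * last_flip 1 (eval_word rep_c u)
  + (e 1%N + e 2%N + e 3%N) * last_flip 1 (eval_word rep_bc u)
  + mu (eval_word gam u))%R.
  have rep x c : all (central_check 1 x) klein_relators ->
      functional (fun u => fix_level n (eval_word grig_autos u))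
      (fun u => c * last_flip 1 (eval_word x u))%R.
    by move=> chk; apply: functionalZ; exact: rep_level2.
  apply: functionalD; last first.
    by apply: (functional_eval muP) => u; rewrite gam_fixE.
  by do 3![apply: functionalD; last by apply: rep; vm_compute];
    apply: rep; vm_compute.
have val x f r : flips_check 1 x f r -> last_flip 1 (eval_word x r) = (f%:R)%R.
  by move/flips_checkP/last_flipE.
have mu0 r : r \in klein_relators -> mu (eval_word gam r) = 0%R.
  have /klein_gensP h := klein_gam; move/h => ->.
  exact: (inv_functional1 (gam_fix_normal n) muP).
have highE r : r \in higher_relators n ->
  (e 0%N * last_flip 1 (eval_word rep_a r)
  + e 1%N * last_flip 1 (eval_word rep_b r)
  + e 2%N * last_flip 1 (eval_word rep_c r)
  + (e 1%N + e 2%N + e 3%N) * last_flip 1 (eval_word rep_bc r)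
  + mu (eval_word gam r))%R = mu (eval_word gam r).
  by move=> hr; rewrite !(rep_level2_pow4 _ hr) !GRing.mulr0 !GRing.add0r.
have vE := size_grig_relators n3.
move=> i; rewrite vE grig_relatorsE => ilt; rewrite nth_cat.
case: ifP => i4.
  have kr := mem_nth [::] i4; rewrite (mu0 _ kr) GRing.addr0 {kr}.
  move: i i4 {ilt}; case=> [|[|[|[|//]]]] _.
  - rewrite (val rep_a true) ?(val rep_b false) ?(val rep_c false)
      ?(val rep_bc false) //.
    by rewrite !GRing.mulr0 GRing.mulr1 !GRing.addr0.
  - rewrite (val rep_a false) ?(val rep_b true) ?(val rep_c false)
      ?(val rep_bc false) //.
    by rewrite !GRing.mulr0 GRing.mulr1 !GRing.addr0 GRing.add0r.
  - rewrite (val rep_a false) ?(val rep_b false) ?(val rep_c true)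
      ?(val rep_bc false) //.
    by rewrite !GRing.mulr0 GRing.mulr1 !GRing.addr0 !GRing.add0r.
  - rewrite (val rep_a false) ?(val rep_b true) ?(val rep_c true)
      ?(val rep_bc true) //.
    rewrite !GRing.mulr0 !GRing.mulr1 GRing.add0r GRing.addrA addF2.
    by rewrite GRing.add0r.
have hr : nth [::] (higher_relators n) (i - 4) \in higher_relators n.
  apply: mem_nth; rewrite -(ltn_add2l 4).
  by rewrite -[(4 + size _)%N]/(size (grig_relators n)) vE subnKC // leqNgt i4.
rewrite (highE _ hr) => {hr}.
have {}i4 : (4 <= i)%N by rewrite leqNgt i4.
rewrite -{2}(subnKC i4); have {ilt} : (i - 4 < 2 * n - 3)%N by lia.
move: (i - 4)%N => {i i4} i ilt.
rewrite /higher_relators !nth_cat size_map size_iota.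
case: ltnP => i1; first by rewrite (nth_map 0%N) ?size_iota // nth_iota // mu_u.
rewrite size_map size_iota; case: ltnP => i2.
  by rewrite (nth_map 0%N) ?size_iota // nth_iota // mu_v // subnKC.
have [e0|e1] : i = (n - 2 + (n - 3 + 0))%N \/ i = (n - 2 + (n - 3 + 1))%N.
  by lia.
- have -> : (i - (n - 2) - (n - 3) = 0)%N by lia.
  by rewrite /= mu_w e0.
- have -> : (i - (n - 2) - (n - 3) = 1)%N by lia.
  by rewrite /= mu_t e1.
Qed.

(** * The finite quotients *)

Lemma grig_quot_eval n u :
  eval_word (grig_quot_gens n) u = 1 <-> fix_level n (eval_word grig_autos u).
Proof.
pose y (i : 'I_3) : grigorchuk := nth 1 [:: grig_a; grig_b; grig_c] i.
have -> : eval_word (grig_quot_gens n) u = to_quotient (stab n) (eval_word y u).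
  by rewrite (eval_morph _ _ (@to_quotientM _ (stab n))).
have -> : eval_word grig_autos u = val (eval_word y u).
  rewrite (eval_morph (f := val : grigorchuk -> treeAut)) //.
  by apply: eq_eval; apply: ord3P.
split=> [/to_quotientP|fix_u].
  rewrite mulg1 => /nsubV; rewrite invgK => /asboolP h w sw; exact: h.
apply/to_quotientP; rewrite mulg1; apply: nsubV; apply/asboolP => w sw.
exact: fix_u.
Qed.

Lemma eval_gen_subgroup (G : groupType) t (x : 'I_t -> G) u :
  eval_word x u \in gen_subgroup (range x).
Proof.
have [g1 gF] := gen_subgroup_closed (range x).
have gV h : h \in gen_subgroup (range x) -> h^-1 \in gen_subgroup (range x).
  by move=> hh; rewrite -[h^-1]mul1g; exact: gF.
elim: u => [|[i e] u IHu]; first by rewrite eval_nil.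
have xi : x i \in gen_subgroup (range x) by apply: mem_gen_subgroup; exists i.
rewrite eval_cons -[eval_word x u]invgK; apply: gF; last exact: gV.
by case: e => //=; exact: gV.
Qed.

Lemma grig_quot_generates n : generates (grig_quot_gens n).
Proof.
move=> g; rewrite -(quot_reprK g); move: (quot_repr g) => {}g.
pose y (i : 'I_3) : grigorchuk := nth 1 [:: grig_a; grig_b; grig_c] i.
have [u ->] : exists u, g = eval_word y u.
  have valE u : val (eval_word y u) = eval_word grig_autos u.
    rewrite (eval_morph (f := val : grigorchuk -> treeAut)) //.
    by apply: eq_eval; apply: ord3P.
  suff [u uE] : exists u, eval_word grig_autos u = val g.
    by exists u; apply: val_inj; rewrite valE uE.
  apply: gen_subgroup_eval (valP g) => s [] ->.
  - by exists [:: (ia, false)]; rewrite eval_cons eval_nil mulg1.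
  - by exists [:: (ib, false)]; rewrite eval_cons eval_nil mulg1.
  - by exists [:: (ic, false)]; rewrite eval_cons eval_nil mulg1.
  - exists [:: (ib, false); (ic, false)].
    by rewrite !eval_cons eval_nil mulg1 -aut_bc.
rewrite (eval_morph _ _ (@to_quotientM _ (stab n))).
exact: (eval_gen_subgroup (grig_quot_gens n)).
Qed.

Lemma grig_quot_presents n : (3 <= n)%N ->
  presents (grig_quot_gens n) (grig_relators n).
Proof.
move=> n3; split; first exact: grig_quot_generates.
move=> u; rewrite grig_quot_eval.
by split; [exact: level_ncl | exact: ncl_fix_level].
Qed.

Lemma grig_relators_square n r : r \in grig_relators n -> exists s, r = s ++ s.
Proof.
rewrite grig_relatorsE mem_cat => /orP[|/higher_relators_pow4[u ->]].
  rewrite !inE => /or4P[]/eqP->;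
    [exists [:: (ia, false)] | exists [:: (ib, false)]
    | exists [:: (ic, false)] | exists [:: (ib, false); (ic, false)]] => //.
by exists (pow_word u 2); rewrite /pow_word /= !cats0 -!catA.
Qed.

(** This is [lower_bound] for d = 3 and the 2n + 1 relators, each written as a square, with the
    functionals dual to them. *)
Lemma grig_quot_lower_bound n t (x : 'I_t -> grig_quot n) R : (3 <= n)%N ->
  presents x R -> (2 * n + 1 + t <= size R + 3)%N.
Proof.
move=> n3 xR; set k := size (grig_relators n).
have [s sE] := choice (fun i : 'I_k =>
  grig_relators_square (mem_nth [::] (ltn_ord i))).
have dual (j : 'I_k) : exists lam,
    functional (fun u => eval_word (grig_quot_gens n) u = 1) lam /\
    forall i : 'I_k, lam (s i ++ s i) = (i == j)%:R%R.
  have [lam [add conj red] lam_rel] :=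
    relator_functional (fun i => (i == j)%:R)%R n3.
  exists lam; split; last by move=> i; rewrite -sE lam_rel.
  split=> [u v /grig_quot_eval Nu /grig_quot_eval|u g /grig_quot_eval|//].
    exact: add.
  exact: conj.
have [lam lamP] := choice dual.
rewrite -size_grig_relators //.
have sN i : eval_word (grig_quot_gens n) (s i ++ s i) = 1.
  by apply/grig_quot_eval; rewrite -sE; apply/(grig_relators_fix n3)/mem_nth.
exact: (lower_bound (@grig_quot_generates n) sN (fun j => proj1 (lamP j))
  (fun i j => proj2 (lamP j) i) xR).
Qed.

Lemma grig_quot_generator_bound n t (x : 'I_t -> grig_quot n) : (3 <= n)%N ->
  generates x -> (3 <= t)%N.
Proof.
move=> n3; apply: (generators_lower_bound (@grig_quot_generates n)) => u.
have [_ /(_ u)-> ] := grig_quot_presents n3; apply: exponents_ncl => r.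
by case/grig_relators_square=> s ->; exact: exponents_square.
Qed.

Theorem theorem4 (n : nat) (hn : (3 <= n)%N) :
  [/\ presents (grig_quot_gens n) (grig_relators n),
      minimal_presentation (grig_quot_gens n) (grig_relators n),
      realizes_deficiency (grig_quot_gens n) (grig_relators n)
    & is_deficiency (grig_quot n) ((2 * n)%:Z - 2%:Z)%R].
Proof.
have pres := grig_quot_presents hn; have sz := size_grig_relators hn.
have def : is_deficiency (grig_quot n) ((2 * n)%:Z - 2%:Z)%R.
  split.
    exists 3, (2 * n + 1)%N; split; last by lia.
    by exists (grig_quot_gens n), (grig_relators n).
  move=> z [t [m [[x [R [<- xR]]] ->]]].
  by have := grig_quot_lower_bound hn xR; lia.
split=> //.
- split=> //.
  + split; first by exists (grig_quot_gens n); case: pres.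
    by move=> t [x x_gen]; exact: (grig_quot_generator_bound hn x_gen).
  + split; first by exists 3; exists (grig_quot_gens n), (grig_relators n).
    (* The bound m >= 2n + 1 + t - 3 is combined with t >= 3. *)
    move=> m [t [x [R [<- xR]]]]; rewrite sz.
    have [x_gen _] := xR; have := grig_quot_generator_bound hn x_gen.
    by have := grig_quot_lower_bound hn xR; lia.
- split=> //; rewrite sz.
  suff -> : ((2 * n + 1)%:Z - 3%:Z = (2 * n)%:Z - 2%:Z)%R by [].
  by lia.
Qed.
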